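(* Let $t$ be a rational integer congruent to $0$, $5$, $8$, $17$, $20$, or $25$ modulo $49$. If the polynomial $$Y^3-tY^2-(2t^2-7t+21)Y+t^3+28$$ is irreducible over $\mathbb{Q}$, then for $y$ a root of it, $\mathbb{Q}(y)$ is a cyclic extension of $\mathbb{Q}$; and if $$p(x)=x^7-21x^5+70x^4-105x^3-28(4t^2-12t+33)x^2+7(96t^2-288t+859)x+64t^3-1264t^2+3792t-9642$$ is likewise irreducible over $\mathbb{Q}$, then the splitting field of $p(x)$ over $K=\mathbb{Q}(\sqrt{-7(t^2-3t+9)},\,y)$ is an unramified cyclic extension of $K$.
   Context: A cyclic extension is a Galois extension with cyclic Galois group. *)

(* Defs.v *)
From HB Require Import structures.
From mathcomp Require Import all_boot all_order all_algebra all_fingroup.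
From mathcomp Require Import all_solvable all_field.

Set Implicit Arguments.
Unset Strict Implicit.
Unset Printing Implicit Defensive.

Import Order.TTheory GRing.Theory Num.Theory.
Local Open Scope ring_scope.

Definition cubic (t : int) : {poly rat} :=
  'X^3 - t%:~R *: 'X^2 - (2 * t ^+ 2 - 7 * t + 21)%:~R *: 'X
  + ((t ^+ 3 + 28)%:~R)%:P.

Definition septic (t : int) : {poly rat} :=
  'X^7 - 21 *: 'X^5 + 70 *: 'X^4 - 105 *: 'X^3
  - (28 * (4 * t ^+ 2 - 12 * t + 33))%:~R *: 'X^2
  + (7 * (96 * t ^+ 2 - 288 * t + 859))%:~R *: 'X
  + ((64 * t ^+ 3 - 1264 * t ^+ 2 + 3792 * t - 9642)%:~R)%:P.

Definition cyclic_extension (F : fieldType) (L : splittingFieldType F)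
    (K E : {subfield L}) : Prop :=
  galois K E /\ cyclic 'Gal(E / K).

Section NumberFields.

(* Number fields are the subfields of an ambient finite extension L of Q;
   subsets of L (rings of integers and their ideals) are predicates in Prop. *)
Variable L : fieldExtType rat.

Definition ring_of_integers (E : {subfield L}) (x : L) : Prop :=
  x \in E /\ integralOver (intmul 1 : int -> L) x.

Definition sub_pred (I J : L -> Prop) : Prop := forall x, I x -> J x.

Definition is_ideal (E : {subfield L}) (I : L -> Prop) : Prop :=
  [/\ sub_pred I (ring_of_integers E), I 0,
      forall x y, I x -> I y -> I (x + y)
    & forall a x, ring_of_integers E a -> I x -> I (a * x)].

Definition is_prime_ideal (E : {subfield L}) (P : L -> Prop) : Prop :=
  [/\ is_ideal E P, ~ P 1
    & forall x y, ring_of_integers E x -> ring_of_integers E y ->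
        P (x * y) -> P x \/ P y].

Definition nonzero_ideal (I : L -> Prop) : Prop := exists2 x, I x & x != 0.

(* The finite sums of products x * y with x in I and y in J. *)
Definition mul_ideal (I J : L -> Prop) (z : L) : Prop :=
  exists2 s : seq (L * L),
    forall u, u \in s -> I u.1 /\ J u.2 & z = \sum_(u <- s) u.1 * u.2.

Fixpoint exp_ideal (E : {subfield L}) (I : L -> Prop) (n : nat) : L -> Prop :=
  if n is m.+1 then mul_ideal I (exp_ideal E I m) else ring_of_integers E.

Definition contract_ideal (K : {subfield L}) (P : L -> Prop) (x : L) : Prop :=
  x \in K /\ P x.

Definition extend_ideal (E : {subfield L}) (p : L -> Prop) : L -> Prop :=
  mul_ideal p (ring_of_integers E).

(* e is the exponent of P in the factorization of the extension to the ring of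
   integers of E of the prime of K below P: for Dedekind domains, divisibility
   by P ^ n is containment in P ^ n. *)
Definition ramification_index (K E : {subfield L}) (P : L -> Prop) (e : nat) :
    Prop :=
  let pE := extend_ideal E (contract_ideal K P) in
  sub_pred pE (exp_ideal E P e) /\ ~ sub_pred pE (exp_ideal E P e.+1).

(* No separability condition on residue fields is needed, as they are finite. *)
Definition unramified_finite (K E : {subfield L}) : Prop :=
  forall P, is_prime_ideal E P -> nonzero_ideal P -> ramification_index K E P 1.

(* No real place of K lies below a complex place of E. *)
Definition unramified_infinite (K E : {subfield L}) : Prop :=
  forall f : {rmorphism subvs_of E -> algC},
    (forall x : subvs_of E, vsval x \in K -> f x \is Num.real) ->
    forall x : subvs_of E, f x \is Num.real.

Definition unramified_extension (K E : {subfield L}) : Prop :=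
  [/\ (K <= E)%VS, unramified_finite K E & unramified_infinite K E].

End NumberFields.

(* Main.v *)
(* Put u = t^2 - 3t + 9 and x = z + 1, so that the septic becomes
   z^7 + 7 z^6 - 112 u z^2 + 448 u z + 64 u (t - 8).

   The discriminant of the cubic is the square of 7u(t - 2), so the cubic is
   cyclic.  Over K(zeta), with zeta a primitive 7th root of unity, the roots of
   the septic are z_i = sum_k A_k zeta^(ik), where A_0 = -1, A_k A_(-k) = 1 and
   A_k^2 A_(-2k) is explicit.  By Fourier inversion the correlations
   sum_j z_(k+j) z_j and sum_(j,l) z_(k-j+2l) z_j z_l lie in K, and they
   determine (z_i) up to a cyclic shift of the indices.  So Gal(E/K) acts on the
   roots by shifts, and it has order 7 because [K : Q] is prime to 7.

   In a Galois extension of prime degree, a prime P of E whose inertia group is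
   trivial has ramification index 1.  If the inertia group is not trivial, all
   conjugates of an integer are congruent modulo P.  When P does not contain 7,
   sum_i (z - z_i) = 7(z + 1) and sum_i (z - z_i)^2 = 7(z + 1)^2 + 42 put z + 1
   and 6 in P, and then the derivative of the septic at z is in P, which is
   impossible.  When P contains 7, the trace of an integer is congruent modulo
   P to 7 times this integer, hence divisible by 7 if it is rational, but the
   Newton polygon at 7 of a translate of the septic gives an integer
   (z - a)^k / 7^h whose trace is a rational integer prime to 7.

   At infinity nothing can ramify because K contains the square root of a
   negative number. *)

Require Import Defs.
From HB Require Import structures.
From mathcomp Require Import all_boot all_order all_algebra all_fingroup.
From mathcomp Require Import all_solvable all_field.
From mathcomp Require Import ring zify.
From Stdlib Require Import Classical.

Set Implicit Arguments.
Unset Strict Implicit.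
Unset Printing Implicit Defensive.

Import Order.TTheory GRing.Theory Num.Theory.
Local Open Scope ring_scope.

(** * Prime ideals of rings of integers *)

(** Index 1 at [P] means that the extension of the prime below lies in [P] but not in the square of
    [P]. The algebraic core is therefore that [P] differs from its square. Were the extension inside
    the square, every element of [K] lying in [P] would be in it too; a trace, or a polynomial with
    conjugation-invariant coefficients, transfers this to an element chosen outside the square.
    Since the degree is prime, only the two extreme decomposition groups occur. The roots of the
    septic are first built in an auxiliary field containing [zeta] and a seventh root, unrelated to
    [E]; they come back to [E] because the septic splits there. Automorphisms of [E] are never
    extended to the auxiliary field: shifts are recognised by correlations, which are elements of
    [K]. The formulas for the resolvents have one origin. Twisting the cubic by the real cubic
    subfield of the 7th cyclotomic field gives three numbers [W1], [W2], [W4] with sum 0 whose other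
    symmetric functions both equal [- u]; these conditions define a rational curve, and every
    resolvent is a monomial in linear factors of its parameter [r] and in the seventh root. The
    residues modulo 49 serve only at the primes containing 7. *)

Section Integers.

Variables (L : fieldExtType rat) (E : {subfield L}).
Local Notation OE := (ring_of_integers E).
Implicit Types x y : L.

Lemma integer_int (n : int) : OE n%:~R.
Proof.
split; first by rewrite -[_%:~R]mulr1 mulrzl rpredMz // rpred1.
exact: (@integral_id int L intr).
Qed.

Lemma integer0 : OE 0. Proof. exact: (integer_int 0). Qed.
Lemma integer1 : OE 1. Proof. exact: (integer_int 1). Qed.
Lemma integer_nat (n : nat) : OE n%:R.
Proof. exact: (integer_int n%:Z). Qed.

Lemma integerD x y : OE x -> OE y -> OE (x + y).
Proof.
by move=> [Ex Ix] [Ey Iy]; split; [rewrite rpredD | apply: integral_add].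
Qed.

Lemma integerM x y : OE x -> OE y -> OE (x * y).
Proof.
by move=> [Ex Ix] [Ey Iy]; split; [rewrite rpredM | apply: integral_mul].
Qed.

Lemma integerN x : OE x -> OE (- x).
Proof. by move=> [Ex Ix]; split; [rewrite rpredN | apply: integral_opp]. Qed.

Lemma integerB x y : OE x -> OE y -> OE (x - y).
Proof. by move=> ? ?; apply: integerD => //; apply: integerN. Qed.

Lemma integerX x n : OE x -> OE (x ^+ n).
Proof.
move=> Ox; elim: n => [|n IH]; first by rewrite expr0; apply: integer1.
by rewrite exprS; apply: integerM.
Qed.

Lemma integer_sum (I : Type) (r : seq I) (Q : pred I) (F : I -> L) :
  (forall i, Q i -> OE (F i)) -> OE (\sum_(i <- r | Q i) F i).
Proof.
by move=> OF; apply: (big_ind OE) => //; [apply: integer0 | apply: integerD].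
Qed.

Lemma integer_prod (I : Type) (r : seq I) (Q : pred I) (F : I -> L) :
  (forall i, Q i -> OE (F i)) -> OE (\prod_(i <- r | Q i) F i).
Proof.
by move=> OF; apply: (big_ind OE) => //; [apply: integer1 | apply: integerM].
Qed.

Lemma integer_horner (q : {poly int}) x :
  OE x -> OE (map_poly intr q).[x].
Proof.
move=> Ox; rewrite horner_coef; apply: integer_sum => i _.
by rewrite coef_map; apply: integerM; [apply: integer_int | apply: integerX].
Qed.

Lemma integer_root_ann x : OE x ->
  exists2 q : {poly int}, q \is monic & root (map_poly intr q) x.
Proof. by case=> _ [q mq rq]; exists q. Qed.

End Integers.

Lemma integer_gal (L : splittingFieldType rat) (E : {subfield L})
    (s : gal_of E) x :
  ring_of_integers E x -> ring_of_integers E (s x).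
Proof.
move=> [Ex [q mq rq]]; split; first exact: memv_gal.
exists q => //; move: rq; rewrite /root => /eqP rq.
have -> : map_poly intr q = map_poly s (map_poly intr q).
  rewrite -map_poly_comp; apply: eq_map_poly => n /=.
  by rewrite rmorph_int.
by rewrite horner_map rq rmorph0.
Qed.

Section PrimeIdeal.

Variables (L : fieldExtType rat) (E : {subfield L}) (P : L -> Prop).
Local Notation OE := (ring_of_integers E).
Hypothesis Pprime : is_prime_ideal E P.
Hypothesis Pnz : nonzero_ideal P.
Implicit Types x y : L.

Lemma prime_idealS x : P x -> OE x.
Proof. by case: Pprime => -[H _ _ _] _ _ /H. Qed.
Lemma prime_ideal0 : P 0. Proof. by case: Pprime => -[]. Qed.
Lemma prime_idealD x y : P x -> P y -> P (x + y).
Proof. by case: Pprime => -[_ _ H _] _ _; apply: H. Qed.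
Lemma prime_idealMl a x : OE a -> P x -> P (a * x).
Proof. by case: Pprime => -[_ _ _ H] _ _; apply: H. Qed.
Lemma prime_idealMr a x : OE a -> P x -> P (x * a).
Proof. by rewrite mulrC; apply: prime_idealMl. Qed.
Lemma prime_idealN x : P x -> P (- x).
Proof.
by rewrite -mulN1r; apply: prime_idealMl; apply: integerN; apply: integer1.
Qed.
Lemma prime_idealB x y : P x -> P y -> P (x - y).
Proof. by move=> ? ?; apply: prime_idealD => //; apply: prime_idealN. Qed.
Lemma prime_ideal1 : ~ P 1. Proof. by case: Pprime. Qed.
Lemma prime_ideal_or x y : OE x -> OE y -> P (x * y) -> P x \/ P y.
Proof. by case: Pprime => _ _; apply. Qed.

Lemma prime_ideal_sum (I : Type) (r : seq I) (Q : pred I) (F : I -> L) :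
  (forall i, Q i -> P (F i)) -> P (\sum_(i <- r | Q i) F i).
Proof.
by move=> PF; apply: (big_ind P) => //;
  [apply: prime_ideal0 | apply: prime_idealD].
Qed.

Lemma prime_ideal_prod_notin (I : Type) (r : seq I) (Q : pred I) (F : I -> L) :
    (forall i, Q i -> OE (F i) /\ ~ P (F i)) ->
  ~ P (\prod_(i <- r | Q i) F i).
Proof.
move=> PF; suff [] : OE (\prod_(i <- r | Q i) F i) /\
  ~ P (\prod_(i <- r | Q i) F i) by [].
apply: (big_ind (fun x => OE x /\ ~ P x)) => //.
  by split; [apply: integer1 | apply: prime_ideal1].
move=> x y [Ox Px] [Oy Py]; split; first exact: integerM.
by move/(prime_ideal_or Ox Oy) => [].
Qed.

(** Once powers of [x] are cancelled from an integral equation of a nonzero [x] in [P], its constant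
    term is a nonzero rational integer in [P]; primality of [P] then passes to one of its prime
    factors. *)
Lemma prime_in_ideal : exists2 l : nat, prime l & P l%:R.
Proof.
have [x Px x0] := Pnz.
have Ox := prime_idealS Px.
have [q mq rq] := integer_root_ann Ox.
have [n n0 Pn] : exists2 n : int, n != 0 & P n%:~R.
  elim/poly_ind: q mq rq => [|q c IH] mq.
    by rewrite monicE lead_coef0 eq_sym oner_eq0 in mq.
  rewrite rmorphD rmorphM /= map_polyX map_polyC /root hornerD hornerM hornerX.
  rewrite hornerC => /eqP rq.
  have [c0|c0] := eqVneq c 0.
    move: rq; rewrite c0 addr0 => /eqP; rewrite mulf_eq0 (negPf x0) orbF.
    apply: IH; move: mq; rewrite c0 addr0 !monicE lead_coefM lead_coefX.
    by rewrite mulr1.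
  exists c => //.
  have -> : c%:~R = - ((map_poly intr q).[x] * x).
    by apply/eqP; rewrite -addr_eq0 addrC rq.
  by apply/prime_idealN/prime_idealMl => //; apply: integer_horner.
have {n0 Pn} [m m0 Pm] : exists2 m : nat, (0 < m)%N & P m%:R.
  exists `|n|%N; first by rewrite absz_gt0.
  rewrite -[_%:R]/(`|n|%N%:Z%:~R) abszE; case: (ger0P n) => // _.
  by rewrite rmorphN; apply: prime_idealN.
elim/ltn_ind: m m0 Pm => m IH m0 Pm.
have [m1|m1] := leqP m 1.
  have m1' : m = 1%N by apply/eqP; rewrite eqn_leq m1.
  by case: prime_ideal1; move: Pm; rewrite m1'.
have [pr|] := boolP (prime m); first by exists m.
case/primePn; first by rewrite ltnNge m1.
move=> [d /andP [d1 dm] /dvdnP [e em]].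
have e0 : (0 < e)%N by move: m0; rewrite em; case: (e).
have em' : (e < m)%N by rewrite em -[X in (X < _)%N]muln1 ltn_pmul2l.
move: Pm; rewrite em natrM =>
  /(prime_ideal_or (integer_nat _ _) (integer_nat _ _)).
by case=> [/IH|/IH]; apply=> //; apply: ltnW.
Qed.

Lemma coprime_ideal_inv (l : nat) (n : int) :
  prime l -> P l%:R -> ~ P n%:~R -> exists m : int, P (m%:~R * n%:~R - 1).
Proof.
move=> prl Pl Pn.
have cop : coprimez l n.
  rewrite coprimezE /= prime_coprime //; apply/negP => ln.
  apply: Pn; have /dvdzP [k ->] : (l %| n)%Z by [].
  by rewrite rmorphM; apply: prime_idealMl; [apply: integer_int|].
have [[u v] /= uv] : exists uv : int * int, uv.1 * l + uv.2 * n = 1.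
  have [u [v uv]] := Bezoutz l n; exists (u, v); rewrite /= uv.
  exact/eqP.
exists v; rewrite -rmorphM /= -[1]/(1%:~R) -rmorphB /=.
have -> : v * n - 1 = - u * l by rewrite -uv; ring.
by rewrite rmorphM; apply: prime_idealMl; [apply: integer_int|].
Qed.

(* In an integral equation for [a], a nonzero constant term modulo [P] can be
   inverted modulo the rational prime in [P], and a zero one lets us cancel
   [a]. *)
Lemma prime_ideal_inv a : OE a -> ~ P a -> exists2 b, OE b & P (b * a - 1).
Proof.
move=> Oa Pa; have [l prl Pl] := prime_in_ideal.
have [q mq] := integer_root_ann Oa; rewrite /root => /eqP rq.
have : P (map_poly intr q).[a] by rewrite rq; apply: prime_ideal0.
elim/poly_ind: q mq {rq} => [|q c IH] mq.
  by rewrite monicE lead_coef0 eq_sym oner_eq0 in mq.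
rewrite rmorphD rmorphM /= map_polyX map_polyC hornerD hornerM hornerX.
rewrite hornerC /= => Pq.
have Oq : OE (map_poly intr q).[a] by apply: integer_horner.
have [Pc|Pc] := classic (P c%:~R).
  have : P ((map_poly intr q).[a] * a).
    have -> : (map_poly intr q).[a] * a =
      (map_poly intr q).[a] * a + c%:~R - c%:~R by rewrite addrK.
    exact: prime_idealB.
  case/(prime_ideal_or Oq Oa) => // Pq'.
  have [q0|q0] := eqVneq q 0.
    exfalso; move: mq; rewrite q0 mul0r add0r monicE lead_coefC => /eqP c1.
    by apply: prime_ideal1; move: Pc; rewrite c1.
  apply: IH => //; move: mq; rewrite !monicE lead_coefDl ?lead_coefM ?lead_coefX
    ?mulr1 // size_mulX // size_polyC.
  by case: (c != 0) => //=; rewrite ltnS size_poly_gt0.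
have [m Pm] := coprime_ideal_inv prl Pl Pc.
exists (- (m%:~R * (map_poly intr q).[a])).
  by apply/integerN/integerM => //; apply: integer_int.
have -> : - (m%:~R * (map_poly intr q).[a]) * a - 1 =
   (m%:~R * c%:~R - 1) - m%:~R * ((map_poly intr q).[a] * a + c%:~R) by ring.
by apply: prime_idealB => //; apply: prime_idealMl => //; apply: integer_int.
Qed.

End PrimeIdeal.

(** * A nonzero prime ideal differs from its square *)

Section SquareIdeal.

Variables (L : fieldExtType rat) (E : {subfield L}) (P : L -> Prop).
Local Notation OE := (ring_of_integers E).
Hypothesis Pprime : is_prime_ideal E P.
Hypothesis Pnz : nonzero_ideal P.
Implicit Types x y : L.

Lemma mul_ideal0 (I J : L -> Prop) : mul_ideal I J 0.
Proof. by exists [::] => //; rewrite big_nil. Qed.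

Lemma mul_idealD (I J : L -> Prop) x y :
  mul_ideal I J x -> mul_ideal I J y -> mul_ideal I J (x + y).
Proof.
move=> [s sP ->] [r rP ->]; exists (s ++ r); last by rewrite big_cat.
by move=> u; rewrite mem_cat => /orP [/sP|/rP].
Qed.

Lemma mul_idealM (I J : L -> Prop) x y : I x -> J y -> mul_ideal I J (x * y).
Proof.
move=> Ix Jy; exists [:: (x, y)]; last by rewrite big_seq1.
by move=> u; rewrite inE => /eqP ->.
Qed.

Lemma mul_idealS (I J I' J' : L -> Prop) :
  sub_pred I I' -> sub_pred J J' -> sub_pred (mul_ideal I J) (mul_ideal I' J').
Proof. by move=> SI SJ x [s sP ->]; exists s => // u /sP [/SI ? /SJ]. Qed.

Lemma mul_ideal_sum (I J : L -> Prop) (T : Type) (r : seq T) (Q : pred T)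
    (F : T -> L) :
  (forall i, Q i -> mul_ideal I J (F i)) ->
  mul_ideal I J (\sum_(i <- r | Q i) F i).
Proof.
by move=> PF; apply: (big_ind (mul_ideal I J)) => //;
  [apply: mul_ideal0 | apply: mul_idealD].
Qed.

Lemma mul_idealMl (I J : L -> Prop) a x :
  (forall y, J y -> J (a * y)) -> mul_ideal I J x -> mul_ideal I J (a * x).
Proof.
move=> aJ [s sP ->]; rewrite big_distrr /= big_seq;
  apply: mul_ideal_sum => u su.
by have [Iu Ju] := sP u su; rewrite mulrCA; apply: mul_idealM => //; apply: aJ.
Qed.

Lemma mul_ideal_sub (J : L -> Prop) :
  sub_pred J OE -> sub_pred (mul_ideal P J) P.
Proof.
move=> JO x [s sP ->]; rewrite big_seq; apply: (prime_ideal_sum Pprime) => u /sP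
  [Pu /JO].
by move=> Ou; apply: (prime_idealMr Pprime).
Qed.

Lemma exp_ideal2 x : exp_ideal E P 2 x <-> mul_ideal P P x.
Proof.
split; apply: mul_idealS => //; first exact: mul_ideal_sub.
by move=> y Py; rewrite -[y]mulr1; apply: mul_idealM => //; apply: integer1.
Qed.

Lemma ideal_sqr_sub : sub_pred (mul_ideal P P) P.
Proof. by apply: mul_ideal_sub; apply: prime_idealS. Qed.

Lemma ideal_sqrMl a x : OE a -> mul_ideal P P x -> mul_ideal P P (a * x).
Proof.
by move=> Oa; apply: mul_idealMl => y; apply: (prime_idealMl Pprime).
Qed.

(** [P] is maximal: with [b] inverse to [a] modulo [P], both terms of [x = b (a x) - (b a - 1) x]
    are in the square. *)
Lemma ideal_sqr_cancel a x :
  OE a -> ~ P a -> P x -> mul_ideal P P (a * x) -> mul_ideal P P x.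
Proof.
move=> Oa Pa Px Pax; have [b Ob Pb] := prime_ideal_inv Pprime Pnz Oa Pa.
have -> : x = b * (a * x) + (- (b * a - 1)) * x by ring.
apply: mul_idealD; first exact: ideal_sqrMl.
by apply: mul_idealM => //; apply: (prime_idealN Pprime).
Qed.

(** In the Leibniz expansion, a permutation other than the identity meets an off-diagonal entry,
    which is in [P]; the identity contributes a product of factors congruent to 1. *)
Lemma det_sub1_ideal n (A : 'M[L]_n) :
  (forall i j, P (A i j)) -> P (\det (1%:M - A) - 1).
Proof.
move=> PA.
have Oij i j : OE ((1%:M - A) i j).
  rewrite !mxE; apply: integerB; last by apply: (prime_idealS Pprime).
  by case: (i == j); [apply: integer1 | apply: integer0].
rewrite /determinant (bigD1 1%g) //= addrAC; apply: (prime_idealD Pprime).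
  rewrite odd_perm1 expr0 mul1r.
  elim/big_rec: _ => [|i y _ Py]; first by rewrite subrr;
    apply: (prime_ideal0 Pprime).
  rewrite perm1 !mxE eqxx.
  have -> : (1%:R - A i i) * y - 1 = (y - 1) - A i i * ((y - 1) + 1) by ring.
  apply: (prime_idealB Pprime) => //; apply: (prime_idealMr Pprime) => //.
  by apply: integerD; [apply: (prime_idealS Pprime) | apply: integer1].
apply: (prime_ideal_sum Pprime) => s s1; apply: (prime_idealMl Pprime).
  by apply: integerX; apply: integerN; apply: integer1.
have /existsP [i si] : [exists i, s i != i].
  rewrite -negb_forall; apply: contra s1 => /forallP H.
  by apply/eqP/permP => i; rewrite perm1; apply/eqP.
rewrite (bigD1 i) //=; apply: (prime_idealMr Pprime).
  by apply: integer_prod => j _; apply: Oij.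
by rewrite !mxE eq_sym (negPf si) sub0r; apply: (prime_idealN Pprime).
Qed.

Section Generators.

Variable l : nat.
Hypothesis prl : prime l.
Hypothesis Pl : P l%:R.

Let lO x := exists2 y, OE y & x = l%:R * y.
Let comb (ps : seq L) (c : nat -> int) := \sum_(i < size ps) (c i)%:~R * ps`_i.
(** Independence, over the field with [l] elements, of the classes of [ps] modulo [l OE]. *)
Let indep (ps : seq L) :=
  forall c : nat -> int, lO (comb ps c) ->
  forall i, (i < size ps)%N -> (l%:Z %| c i)%Z.

Let lnz : l%:R != 0 :> L.
Proof.
by rewrite -(rmorph_nat (in_alg L)) fmorph_eq0 pnatr_eq0 -lt0n prime_gt0.
Qed.

Let lO0 : lO 0.
Proof. by exists 0; [apply: integer0 | rewrite mulr0]. Qed.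

(** Infinite descent: the coefficients of a relation are divisible by [l], and their quotients by
    [l] form a relation again. *)
Let indep_descent ps (c : nat -> int) : indep ps -> comb ps c = 0 ->
  forall e i, (i < size ps)%N -> ((l ^ e)%N%:Z %| c i)%Z.
Proof.
move=> indps c0 e; elim: e c c0 => [|e IH] c c0 i ips; first by rewrite dvd1z.
have lc j : (j < size ps)%N -> (l%:Z %| c j)%Z.
  by apply: indps; rewrite c0.
pose c' j := (c j %/ l)%Z.
have cE j : (j < size ps)%N -> c j = c' j * l by move=> /lc /divzK.
have c'0 : comb ps c' = 0.
  apply: (mulfI lnz); rewrite mulr0 -[RHS]c0 /comb big_distrr /=.
  apply: eq_bigr => j _; rewrite cE // rmorphM /= -[l%:~R]/(l%:R : L); ring.
rewrite cE // expnS mulnC PoszM; apply: dvdz_mul => //.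
exact: IH.
Qed.

(** A rational relation, cleared of denominators, has coefficients divisible by all powers of [l],
    so they vanish: independence modulo [l] implies freeness over the rationals. *)
Let indep_size ps : indep ps -> (size ps <= \dim {:L})%N.
Proof.
move=> indps; suff /eqnP <- : free (in_tuple ps) by rewrite dimvS ?subvf.
apply/freeP => k k0 i.
have [q [a a0 qE]] := rat_poly_scale (\poly_(j < size ps) oapp k 0 (insub j)).
have qk (j : 'I_(size ps)) : k j = a%:~R^-1 * (q`_j)%:~R.
  have := congr1 (fun p : {poly rat} => p`_j) qE.
  by rewrite coef_poly ltn_ord valK /= coefZ coef_map.
have q0 : comb ps (fun j => q`_j) = 0.
  rewrite -[RHS](scaler0 _ (a%:~R : rat)) -[in RHS]k0 scaler_sumr.
  apply: eq_bigr => j _; rewrite scalerA qk mulrA mulfV ?intr_eq0 // mul1r.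
  by rewrite scaler_int mulrzl.
have qi0 : q`_i = 0.
  apply/eqP; rewrite -absz_eq0; apply: contraT; rewrite -lt0n => qi.
  have := indep_descent indps q0 `|(q`_i)%R|%N (ltn_ord i).
  rewrite dvdzE /= => /(dvdn_leq qi); rewrite leqNgt ltn_expl //.
  exact: prime_gt1.
by rewrite qk qi0 mulr0.
Qed.

Let comb_rcons ps x c :
  comb (rcons ps x) c = comb ps c + (c (size ps))%:~R * x.
Proof.
rewrite /comb size_rcons big_ord_recr /= nth_rcons ltnn eqxx; congr (_ + _).
by apply: eq_bigr => i _; rewrite nth_rcons ltn_ord.
Qed.

Let max_indep : exists2 ps, {in ps, forall p, P p} /\ indep ps &
  forall x, P x -> ~ indep (rcons ps x).
Proof.
apply: NNPP => nomax.
have step n : exists2 ps, {in ps, forall p, P p} /\ indep ps & size ps = n.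
  elim: n => [|n [ps [Pps indps] <-]]; first by exists [::].
  have [[x Px indx]|H] := classic (exists2 x, P x & indep (rcons ps x)).
    exists (rcons ps x); last by rewrite size_rcons.
    by split=> // p; rewrite mem_rcons inE => /orP [/eqP ->|/Pps].
  case: nomax; exists ps => // x Px indx; case: H; exists x => //.
have [ps [_ /indep_size]] := step (\dim {:L}).+1.
by move=> + sz; rewrite sz ltnn.
Qed.

(** Maximality gives a nontrivial relation modulo [l] between [ps] and [x]. The coefficient of [x]
    is prime to [l], otherwise [ps] itself would be dependent, so Bezout solves for [x]. *)
Let max_indep_gen ps : indep ps -> (forall x, P x -> ~ indep (rcons ps x)) ->
  forall x, P x -> exists c : nat -> int, lO (x - comb ps c).
Proof.
move=> indps maxps x Px.
have [c [y Oy cE] [i]] : exists2 c, lO (comb (rcons ps x) c) &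
    exists2 i, (i < (size ps).+1)%N & ~ (l%:Z %| c i)%Z.
  apply: NNPP => H; apply: (maxps x Px) => c lc i; rewrite size_rcons => ips.
  by apply: NNPP => nd; case: H; exists c => //; exists i.
move: cE; rewrite comb_rcons; set n := c _ => cE ips ndi.
have nl : ~ (l%:Z %| n)%Z.
  move=> /dvdzP [k nE]; apply: ndi.
  have H j : (j < size ps)%N -> (l%:Z %| c j)%Z.
    apply: indps; exists (y - k%:~R * x).
      apply: integerB => //; apply: integerM; first exact: integer_int.
      exact: (prime_idealS Pprime).
    rewrite mulrBr -cE nE rmorphM /= -[l%:~R]/(l%:R : L); ring.
  move: ips; rewrite ltnS leq_eqVlt => /orP [/eqP ->|/H //].
  by apply/dvdzP; exists k.
have [u [v uv]] := Bezoutz l n.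
have {}uv : u * l%:Z + v * n = 1.
  rewrite uv; apply/eqP; change (coprimez l n).
  by rewrite coprimezE /= prime_coprime //; apply/negP.
exists (fun j => - v * c j); exists (u%:~R * x + v%:~R * y).
  by apply: integerD; apply: integerM => //; try exact: integer_int;
    apply: (prime_idealS Pprime).
have -> : comb ps (fun j => - v * c j) = - v%:~R * comb ps c.
  rewrite /comb big_distrr /=; apply: eq_bigr => j _.
  by rewrite rmorphM rmorphN /= mulrA.
have {1}-> : x = (u%:~R * l%:R + v%:~R * n%:~R) * x.
  by rewrite -[l%:R]/(l%:Z%:~R) -!rmorphM -rmorphD uv mul1r.
have -> : comb ps c = l%:R * y - n%:~R * x by rewrite -cE addrK.
ring.
Qed.

(** A maximal independent family in [P] generates it modulo [l OE], and [l] is itself in [P]. It is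
    put first because the determinant argument below needs a generator known to be nonzero. *)
Lemma ideal_fg : exists gs : seq L, [/\ gs`_0 = l%:R, (0 < size gs)%N,
  {in gs, forall g, P g} & forall x, P x -> exists2 o : nat -> L,
     forall i, OE (o i) & x = \sum_(i < size gs) o i * gs`_i].
Proof.
have [ps [Pps indps] maxps] := max_indep.
exists (l%:R :: ps); split=> //.
  by move=> g; rewrite inE => /orP [/eqP ->|/Pps].
move=> x /(max_indep_gen indps maxps) [c [y Oy xE]].
exists (fun i => if i is j.+1 then (c j)%:~R else y).
  by case=> // n; apply: integer_int.
rewrite big_ord_recl /= [y * _]mulrC -xE addrC.
by rewrite -[LHS](subrK (comb ps c)) addrC.
Qed.

End Generators.

(** Nakayama's determinant trick: if [P] were its own square, its generators would satisfy [g = M g]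
    with entries of [M] in [P]. Then [det (1 - M)] kills the generator [l], hence is 0, although it
    is congruent to 1 modulo [P]. *)
Lemma ideal_sqr_proper : exists2 x, P x & ~ mul_ideal P P x.
Proof.
apply: NNPP => H.
have PP x : P x -> mul_ideal P P x.
  by move=> Px; apply: NNPP => nx; apply: H; exists x.
have [l prl Pl] := prime_in_ideal Pprime Pnz.
have [gs [g0 gs0 Pgs genP]] := ideal_fg prl Pl.
have genPP x : P x -> exists2 o : nat -> L,
    forall i, P (o i) & x = \sum_(i < size gs) o i * gs`_i.
  move/PP => [s sP ->]; elim: s sP => [|u s IH] sP.
    exists (fun=> 0) => [i|]; first exact: (prime_ideal0 Pprime).
    by rewrite big_nil big1 // => i _; rewrite mul0r.
  have [|o Po oE] := IH; first by move=> v vs; apply: sP; rewrite inE vs orbT.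
  have [Pu1 Pu2] := sP u (mem_head _ _).
  have [o' Oo' uE] := genP _ Pu2.
  exists (fun i => u.1 * o' i + o i) => [i|].
    by apply: (prime_idealD Pprime) => //; apply: (prime_idealMr Pprime).
  rewrite big_cons oE {1}uE big_distrr -big_split /=; apply: eq_bigr => i _.
  by rewrite mulrA -mulrDl.
have : forall i : 'I_(size gs), exists o : {ffun 'I_(size gs) -> L},
    (forall j, P (o j)) /\ gs`_i = \sum_j o j * gs`_j.
  move=> i; have [|o Po oE] := genPP gs`_i; first by apply/Pgs/mem_nth.
  exists [ffun j => o (val j)]; split=> [j|]; first by rewrite ffunE.
  by rewrite {1}oE; apply: eq_bigr => j _; rewrite ffunE.
move/fin_all_exists => [A AP].
pose M : 'M[L]_(size gs) := \matrix_(i, j) A i j.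
pose g : 'cV[L]_(size gs) := \col_i gs`_i.
have Mg : (1%:M - M) *m g = 0.
  rewrite mulmxBl mul1mx; apply/eqP; rewrite subr_eq0; apply/eqP/colP => i.
  rewrite !mxE (proj2 (AP i)); apply: eq_bigr => j _; by rewrite !mxE.
have detM : P (\det (1%:M - M) - 1).
  by apply: det_sub1_ideal => i j; rewrite mxE; apply: (proj1 (AP i)).
have det0 : \det (1%:M - M) = 0.
  have : \det (1%:M - M) *: g = 0.
    by rewrite -mul_scalar_mx -mul_adj_mx -mulmxA Mg mulmx0.
  move/colP => /(_ (Ordinal gs0)); rewrite !mxE /= g0 => /eqP.
  rewrite mulf_eq0 => /orP [/eqP //|].
  by rewrite -(rmorph_nat (in_alg L)) fmorph_eq0 pnatr_eq0 -[_ == _]negbK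
    -lt0n prime_gt0.
apply: (prime_ideal1 Pprime); rewrite -[1]opprK; apply: (prime_idealN Pprime).
by rewrite -[- 1]add0r -det0.
Qed.

End SquareIdeal.

(** * Ramification in Galois extensions of prime degree *)

Section PrimeDegree.

Variables (L : splittingFieldType rat) (K E : {subfield L}) (P : L -> Prop).
Local Notation OE := (ring_of_integers E).
Local Notation G := 'Gal(E / K)%g.
Hypothesis galKE : galois K E.
Hypothesis prG : prime #|G|.
Hypothesis Pprime : is_prime_ideal E P.
Hypothesis Pnz : nonzero_ideal P.
Implicit Types (x y : L) (s t : gal_of E).

Let PE x : P x -> x \in E. Proof. by case/(prime_idealS Pprime). Qed.
Let OP x : P x -> OE x. Proof. exact: (prime_idealS Pprime). Qed.
Let OEE x : OE x -> x \in E. Proof. by case. Qed.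

Lemma gal_prime_gen s t : s \in G -> s != 1%g -> t \in G ->
  exists n, t = (s ^+ n)%g.
Proof.
move=> Gs s1 Gt.
suff /cycleP : t \in <[s]>%g by [].
have <- : G :=: <[s]>%g; last by [].
apply/eqP; rewrite eq_sym eqEcard cycle_subG Gs /=.
have /primeP [_ /(_ _ (order_dvdG Gs)) /pred2P [o1|o1]] := prG; last first.
  by rewrite -[#|<[s]>%g|]/#[s]%g o1.
by move: s1; rewrite -order_eq1 o1 eqxx.
Qed.

Lemma gal_fixed x :
  x \in E -> (forall s, s \in G -> s x = x) -> x \in K.
Proof.
move=> Ex fx; have /galois_fixedField <- := galKE.
exact/fixedFieldP.
Qed.

Let stable s := forall y, P y -> P (s y).

Let stableX s n : stable s -> stable (s ^+ n)%g.
Proof.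
move=> ss; elim: n => [|n IH] y Py; first by rewrite expg0 gal_id.
by rewrite expgSr galM ?PE //; apply/ss/IH.
Qed.

(** What ramification at [P] gives: the extension of the prime below is inside the square of [P]. It
    is applied with [c] a trace, or a coefficient of a conjugation-invariant polynomial. *)
Let traces_in_square :=
  forall c a, c \in K -> P c -> OE a -> mul_ideal P P (c * a).

(** When the decomposition group is trivial, some [a] outside [P] has all its other conjugates in
    [P]. The trace of [a ^ 2 p] is in the square by assumption, and so are all its terms but the
    first; hence [a ^ 2 p] is too, and [a ^ 2] cancels. *)
Lemma inertia_split s : s \in G -> ~ stable s -> ~ traces_in_square.
Proof.
move=> Gs nss PP.
have s1 : s != 1%g.
  by apply: contra_notN nss => /eqP -> y; rewrite gal_id.
have /fin_all_exists [a_ aP] : forall t, exists a,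
    t \in G -> t != 1%g -> [/\ OE a, ~ P a & P (t a)].
  move=> t; have [Gt|] := boolP (t \in G); last by exists 0.
  have [->|t1] := eqVneq t 1%g; first by exists 0 => _ /eqP.
  apply: NNPP => H; apply: nss.
  have [n ->] : exists n, s = (t^-1 ^+ n)%g.
    by apply: gal_prime_gen; rewrite ?groupV ?invg_eq1.
  apply: stableX => y Py; apply: NNPP => ny; apply: H; exists (t^-1 y)%g => _ _.
  split=> //; first by apply: integer_gal; apply: OP.
  by rewrite -galM ?PE // mulVg gal_id.
pose a := \prod_(t in G | t != 1%g) a_ t.
have Oa : OE a by apply: integer_prod => t /andP [Gt t1]; case: (aP t Gt t1).
have Pa : ~ P a.
  apply: (prime_ideal_prod_notin Pprime) => t /andP [Gt t1].
  by case: (aP t Gt t1).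
have Pta t : t \in G -> t != 1%g -> P (t a).
  move=> Gt t1; rewrite /a (bigD1 t) ?Gt //= rmorphM /=.
  have [_ _ Pt] := aP t Gt t1; apply: (prime_idealMr Pprime) => //.
  apply/integer_gal/integer_prod => r /andP [/andP [Gr r1] _].
  by case: (aP r Gr r1).
have [p Pp nPp] := ideal_sqr_proper Pprime Pnz.
apply: nPp; apply: (@ideal_sqr_cancel _ _ _ Pprime Pnz (a * a)) => //.
- exact: integerM.
- by move/(prime_ideal_or Pprime Oa Oa) => [].
(* The factor [a] occurs twice so that, for [t] other than 1, [t w] contains two factors from [P];
   nothing is known of [t p] beyond integrality. *)
pose w := a * a * p.
have Pw : P w by apply: (prime_idealMl Pprime) => //; apply: integerM.
have P2t t : t \in G -> t != 1%g -> mul_ideal P P (t w).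
  move=> Gt t1; rewrite /w !rmorphM /= -mulrA; apply: mul_idealM;
    first exact: Pta.
  apply: (prime_idealMr Pprime); last exact: Pta.
  by apply: integer_gal; apply: OP.
have P2tr : mul_ideal P P (galTrace K E w * 1).
  apply: PP; last exact: integer1.
    by apply: mem_galTrace => //; apply: PE.
  rewrite /galTrace (bigD1 1%g) ?group1 //= gal_id.
  apply: (prime_idealD Pprime) => //; apply: (prime_ideal_sum Pprime) => t.
  by move=> /andP [Gt t1]; apply: (ideal_sqr_sub Pprime); apply: P2t.
rewrite mulr1 /galTrace (bigD1 1%g) ?group1 //= gal_id in P2tr.
rewrite -/w -[w](addrK (\sum_(i in G | i != 1%g) i w)).
apply: mul_idealD => //; rewrite -mulN1r.
apply: (ideal_sqrMl Pprime); first by apply: integerN; apply: integer1.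
by apply: mul_ideal_sum => t /andP [Gt t1]; apply: P2t.
Qed.

Lemma integer_coefM (p q : {poly L}) :
  (forall i, OE p`_i) -> (forall i, OE q`_i) -> forall i, OE (p * q)`_i.
Proof.
move=> Op Oq i; rewrite coefM; apply: integer_sum => j _.
exact: integerM.
Qed.

(* The polynomial [u] interpolates [s x |-> s p * f'(s x)] on the conjugates of
   [x]; its coefficients are traces from [P]. *)
Lemma inertia_inert s x : s \in G -> stable s -> OE x -> ~ P (s x - x) ->
  ~ traces_in_square.
Proof.
move=> Gs ss Ox nPx PP.
have s1 : s != 1%g.
  by apply: contra_notN nPx => /eqP ->; rewrite gal_id subrr;
    apply: prime_ideal0 Pprime.
have st t : t \in G -> stable t.
  by move=> Gt; have [n ->] := gal_prime_gen Gs s1 Gt; apply: stableX.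
have nPt t : t \in G -> t != 1%g -> ~ P (t x - x).
  move=> Gt t1 Pt; apply: nPx; have [n ->] := gal_prime_gen Gt t1 Gs.
  elim: n => [|n IH]; first by rewrite expg0 gal_id subrr;
    apply: prime_ideal0 Pprime.
  rewrite expgSr galM ?OEE //.
  have -> : t ((t ^+ n)%g x) - x = t ((t ^+ n)%g x - x) + (t x - x).
    by rewrite rmorphB /= addrA subrK.
  by apply: (prime_idealD Pprime) => //; apply: (st _ Gt).
have [p Pp nPp] := ideal_sqr_proper Pprime Pnz.
pose u := \sum_(t in G) (t p)%:P * \prod_(r in G | r != t) ('X - (r x)%:P).
have Pu i : P u`_i.
  rewrite coef_sum; apply: (prime_ideal_sum Pprime) => t Gt; rewrite coefCM.
  apply: (prime_idealMr Pprime); last exact: (st _ Gt).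
  move: i; apply: (big_ind (fun q : {poly L} => forall i, OE q`_i)).
  - by move=> i; rewrite coef1; apply: integer_nat.
  - by move=> q q'; apply: integer_coefM.
  move=> r _ i; rewrite coefB coefX coefC; apply: integerB.
    exact: integer_nat.
  by case: (i == _); [apply: integer_gal | apply: integer0].
have Ku i : u`_i \in K.
  apply: gal_fixed; first exact: PE.
  move=> g Gg; rewrite -coef_map; suff -> : map_poly g u = u by [].
  rewrite /u raddf_sum [RHS](reindex_inj (mulIg g)) /=.
  apply: eq_big => [t|t Gt]; first by rewrite groupMr.
  rewrite rmorphM /= map_polyC /= galM ?PE //; congr (_ * _).
  rewrite rmorph_prod [RHS](reindex_inj (mulIg g)) /=.
  apply: eq_big => [r|r Gr]; first by rewrite groupMr // (inj_eq (mulIg g)).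
  by rewrite rmorphB /= map_polyX map_polyC /= galM ?OEE.
have : mul_ideal P P u.[x].
  rewrite horner_coef; apply: mul_ideal_sum => i _; apply: PP => //.
  exact: integerX.
have -> : u.[x] = (\prod_(r in G | r != 1%g) (x - r x)) * p.
  rewrite /u horner_sum (bigD1 1%g) ?group1 //= [X in _ + X]big1 ?addr0.
    rewrite hornerM hornerC gal_id mulrC horner_prod; congr (_ * _).
    by apply: eq_bigr => r _; rewrite hornerXsubC.
  move=> t /andP [Gt t1]; rewrite hornerM horner_prod (bigD1 1%g) /=.
    by rewrite hornerXsubC gal_id subrr mul0r mulr0.
  by rewrite group1 eq_sym.
move/(ideal_sqr_cancel Pprime Pnz) => H; apply/nPp/H => //.
  apply: integer_prod => r _; apply: integerB => //; exact: integer_gal.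
apply: (prime_ideal_prod_notin Pprime) => r /andP [Gr r1]; split.
  by apply: integerB => //; apply: integer_gal.
move/(prime_idealN Pprime); rewrite opprB; exact: nPt.
Qed.

(** The hypothesis says that [s] is not in the inertia group. The two cases, [s] stabilising [P] or
    not, are the inert and the split one. *)
Lemma ramification_index1 s x :
  s \in G -> OE x -> ~ P (s x - x) -> ramification_index K E P 1.
Proof.
move=> Gs Ox nPx; split.
  by apply: mul_idealS => // y [].
move=> ram.
have PP : traces_in_square.
  move=> c a Kc Pc Oa; apply/(exp_ideal2 Pprime); apply: ram.
  by apply: mul_idealM.
have [ss|ns] := classic (stable s); first exact: (inertia_inert Gs ss Ox nPx).
exact: (inertia_split Gs ns).
Qed.

End PrimeDegree.

(** * Lagrange resolvents of the septic *)

Definition pol7 (F : comRingType) (a x0 x1 x2 x3 x4 x5 x6 : F) : F :=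
  x0 + x1 * a + x2 * a ^+ 2 + x3 * a ^+ 3 + x4 * a ^+ 4 + x5 * a ^+ 5
  + x6 * a ^+ 6.

(** Multiplication with exponents reduced by [a ^ 7 = c]. It turns identities between values at [a]
    into seven identities of rational functions of [r], one for each power of [a]. *)
Lemma pol7M (F : comRingType) (a c x0 x1 x2 x3 x4 x5 x6
    y0 y1 y2 y3 y4 y5 y6 : F) : a ^+ 7 = c ->
  pol7 a x0 x1 x2 x3 x4 x5 x6 * pol7 a y0 y1 y2 y3 y4 y5 y6 =
  pol7 a
    (x0 * y0 + c * (x1 * y6 + x2 * y5 + x3 * y4 + x4 * y3 + x5 * y2 + x6 * y1))
    (x0 * y1 + x1 * y0 + c * (x2 * y6 + x3 * y5 + x4 * y4 + x5 * y3 + x6 * y2))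
    (x0 * y2 + x1 * y1 + x2 * y0 + c * (x3 * y6 + x4 * y5 + x5 * y4 + x6 * y3))
    (x0 * y3 + x1 * y2 + x2 * y1 + x3 * y0 + c * (x4 * y6 + x5 * y5 + x6 * y4))
    (x0 * y4 + x1 * y3 + x2 * y2 + x3 * y1 + x4 * y0 + c * (x5 * y6 + x6 * y5))
    (x0 * y5 + x1 * y4 + x2 * y3 + x3 * y2 + x4 * y1 + x5 * y0 + c * (x6 * y6))
    (x0 * y6 + x1 * y5 + x2 * y4 + x3 * y3 + x4 * y2 + x5 * y1 + x6 * y0).
Proof. by move=> <-; rewrite /pol7; ring. Qed.

Section KummerRoot.

Variables (F : fieldType) (r a : F).
Hypotheses (n2 : 2 != 0 :> F) (r0 : r != 0) (r1 : r - 1 != 0) (r3 : r - 3 != 0).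
Hypotheses (rm1 : r + 1 != 0) (rm3 : r + 3 != 0).
Hypothesis a7 : a ^+ 7 =
  (r + 1) ^+ 2 * (r + 3) ^+ 3 / (r * (r - 1) ^+ 3 * (r - 3) ^+ 2).

(** The coordinates [q] and [t] of the point of parameter [r], as found in [kummer_parameter]; [q]
    is a square root of [t ^ 2 - 3 t + 9]. *)
Let q := (r ^+ 2 + 3) ^+ 3 / (4 * r * (r - 1) * (r - 3) * (r + 1) * (r + 3)).
Let t := (r ^+ 6 + 6 * r ^+ 5 - 45 * r ^+ 4 - 60 * r ^+ 3 + 135 * r ^+ 2
  + 54 * r - 27) / (4 * r * (r - 1) * (r - 3) * (r + 1) * (r + 3)).

(* The coefficient of [a ^+ k] is the quotient of the k-th Lagrange resolvent by
   the k-th power of the first one. *)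
Definition kummer_sum : F :=
  pol7 a
    (- 1)
    (1)
    ((r - 1) * (r - 3) / ((r + 1) * (r + 3)))
    ((- 1) * (r - 1) * (r - 3) / ((r + 1) * (r + 3)))
    ((- 1) * r * (r - 1) ^+ 2 * (r - 3) / ((r + 1) * (r + 3) ^+ 2))
    (r * (r - 1) ^+ 2 * (r - 3) / ((r + 1) * (r + 3) ^+ 2))
    (r * (r - 1) ^+ 3 * (r - 3) ^+ 2 / ((r + 1) ^+ 2 * (r + 3) ^+ 3)).
Let z := kummer_sum.

Let n4 : 4 != 0 :> F.
Proof. by rewrite (_ : 4 = 2 * 2) ?mulf_neq0 //; ring. Qed.

Let z2E : z ^+ 2 =
  pol7 a
    (7)
    ((r ^+ 3 - 2 * r ^+ 2 - 25 * r - 6) / ((r + 1) * (r + 3)))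
    ((- 2 * r ^+ 3 - 3 * r ^+ 2 + 22 * r - 9) / ((r + 1) * (r + 3)))
    ((- r ^+ 3 + 16 * r ^+ 2 - 3 * r - 36) * (r - 1) / ((r + 1) * (r + 3) ^+ 2))
    ((4 * r ^+ 3 - r ^+ 2 - 16 * r - 3) * (r - 1) * (r - 3)
      / ((r + 1) ^+ 2 * (r + 3) ^+ 2))
    ((- 3 * r ^+ 3 - 22 * r ^+ 2 - 9 * r + 18) * (r - 1) ^+ 2 * (r - 3)
      / ((r + 1) ^+ 2 * (r + 3) ^+ 3))
    ((- 2 * r ^+ 3 + 25 * r ^+ 2 - 6 * r - 9) * (r - 1) ^+ 2 * (r - 3)
      / ((r + 1) ^+ 2 * (r + 3) ^+ 3)).
Proof.
rewrite expr2 /z (pol7M _ _ _ _ _ _ _ _ _ _ _ _ _ _ a7).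
by congr pol7; field; rewrite ?r0 ?r1 ?r3 ?rm1 ?rm3.
Qed.

Let z3E : z ^+ 3 =
  pol7 a
    ((- 49))
    ((- 8 * r ^+ 5 + 44 * r ^+ 4 + 127 * r ^+ 3 - 429 * r ^+ 2 - 135 * r + 81)
      / (r * (r - 3) * (r + 1) * (r + 3)))
    ((9 * r ^+ 5 + 66 * r ^+ 4 - 121 * r ^+ 3 - 381 * r ^+ 2 + 144 * r + 27)
      / (r * (r + 1) * (r + 3) ^+ 2))
    ((3 * r ^+ 5 - 104 * r ^+ 4 - 10 * r ^+ 3 + 412 * r ^+ 2 - 57 * r - 180)
      / ((r + 1) ^+ 2 * (r + 3) ^+ 2))
    ((- 20 * r ^+ 5 + 19 * r ^+ 4 + 412 * r ^+ 3 + 30 * r ^+ 2 - 936 * r - 81)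
      * (r - 1) / ((r + 1) ^+ 2 * (r + 3) ^+ 3))
    ((- r ^+ 5 + 16 * r ^+ 4 + 127 * r ^+ 3 - 121 * r ^+ 2 - 198 * r + 81)
      * (r - 1) * (r - 3) / ((r + 1) ^+ 2 * (r + 3) ^+ 3))
    ((3 * r ^+ 5 + 15 * r ^+ 4 - 143 * r ^+ 3 - 127 * r ^+ 2 + 132 * r + 72)
      * (r - 1) ^+ 2 * (r - 3) / ((r + 1) ^+ 3 * (r + 3) ^+ 3)).
Proof.
rewrite exprSr z2E /z (pol7M _ _ _ _ _ _ _ _ _ _ _ _ _ _ a7).
by congr pol7; field; rewrite ?r0 ?r1 ?r3 ?rm1 ?rm3.
Qed.

Let z34E : z ^+ 3 * (z + 7) = 4 * q *
  pol7 a
    (0)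
    (- 4 * r * (3 * r + 1) / ((r + 1) * (r + 3)))
    ((r + 5) * (r - 1) / (r + 1))
    (- 2 * (2 * r + 3) * (r - 1) * (r - 3) / (r + 3) ^+ 2)
    (2 * (r - 2) * (r - 1) * (r - 3) ^+ 2 / ((r + 1) * (r + 3) ^+ 2))
    ((5 * r - 3) * (r - 1) ^+ 3 * (r - 3) / ((r + 1) ^+ 2 * (r + 3) ^+ 2))
    (- 4 * (r - 9) * r * (r - 1) ^+ 2 * (r - 3)
      / ((r + 1) ^+ 2 * (r + 3) ^+ 3)).
Proof.
have -> : z + 7 = pol7 a
    (6)
    (1)
    ((r - 1) * (r - 3) / ((r + 1) * (r + 3)))
    ((- 1) * (r - 1) * (r - 3) / ((r + 1) * (r + 3)))
    ((- 1) * r * (r - 1) ^+ 2 * (r - 3) / ((r + 1) * (r + 3) ^+ 2))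
    (r * (r - 1) ^+ 2 * (r - 3) / ((r + 1) * (r + 3) ^+ 2))
    (r * (r - 1) ^+ 3 * (r - 3) ^+ 2 / ((r + 1) ^+ 2 * (r + 3) ^+ 3)).
  by rewrite /z /kummer_sum /pol7; ring.
have -> : forall x0 x1 x2 x3 x4 x5 x6, 4 * q * pol7 a x0 x1 x2 x3 x4 x5 x6 =
    pol7 a (4 * q * x0) (4 * q * x1) (4 * q * x2) (4 * q * x3) (4 * q * x4)
      (4 * q * x5) (4 * q * x6).
  by move=> *; rewrite /pol7; ring.
rewrite z3E (pol7M _ _ _ _ _ _ _ _ _ _ _ _ _ _ a7) /q.
by congr pol7; field; rewrite ?n4 ?r0 ?r1 ?r3 ?rm1 ?rm3.
Qed.

Lemma kummer_sum_root : z ^+ 7 + 7 * z ^+ 6 - 112 * q ^+ 2 * z ^+ 2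
  + 448 * q ^+ 2 * z + 64 * q ^+ 2 * (t - 8) = 0.
Proof.
(* Since [z ^ 3 (z + 7)] is divisible by [4 q], this grouping lets the factor be removed from the
   whole equation before coefficients are compared. *)
have -> : z ^+ 7 + 7 * z ^+ 6 - 112 * q ^+ 2 * z ^+ 2
    + 448 * q ^+ 2 * z + 64 * q ^+ 2 * (t - 8) =
  z ^+ 3 * (z ^+ 3 * (z + 7)) -
  4 * q * (q * (28 * z ^+ 2 - 112 * z - 16 * (t - 8))) by ring.
rewrite z34E mulrCA -mulrBr.
rewrite [X in _ * X](_ : _ = 0) ?mulr0 //; apply/eqP; rewrite subr_eq0.
apply/eqP; rewrite z3E (pol7M _ _ _ _ _ _ _ _ _ _ _ _ _ _ a7) z2E.
have -> : forall x0 x1 x2 x3 x4 x5 x6 y0 y1 y2 y3 y4 y5 y6,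
    q * (28 * pol7 a x0 x1 x2 x3 x4 x5 x6 - 112 * pol7 a y0 y1 y2 y3 y4 y5 y6
      - 16 * (t - 8)) =
    pol7 a (q * (28 * x0 - 112 * y0 - 16 * (t - 8))) (q * (28 * x1 - 112 * y1))
      (q * (28 * x2 - 112 * y2)) (q * (28 * x3 - 112 * y3))
      (q * (28 * x4 - 112 * y4)) (q * (28 * x5 - 112 * y5))
      (q * (28 * x6 - 112 * y6)).
  by move=> *; rewrite /pol7; ring.
rewrite /q /t.
by congr pol7; field; rewrite ?n4 ?r0 ?r1 ?r3 ?rm1 ?rm3.
Qed.

End KummerRoot.

(** * Fourier transform and correlations on the integers modulo 7 *)

Section Fourier.

Variables (F : fieldType) (zeta : F).
Hypotheses (n7 : 7 != 0 :> F) (zetaP : 7.-primitive_root zeta).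
Implicit Types (z : 'Z_7 -> F) (i j k l : 'Z_7).

Definition chi k : F := zeta ^+ k.

Lemma chi0 : chi 0 = 1. Proof. exact: expr0. Qed.

Lemma chiD k l : chi (k + l) = chi k * chi l.
Proof. by rewrite /chi -exprD /= -(prim_expr_mod zetaP (k + l)). Qed.

Lemma chiN k : chi (- k) * chi k = 1.
Proof. by rewrite -chiD addNr chi0. Qed.

Lemma chi_eq1 k : (chi k == 1) = (k == 0).
Proof.
rewrite /chi -(prim_order_dvd zetaP) /dvdn modn_small //.

Qed.

Lemma sum_chi k : \sum_i chi (i * k) = if k == 0 then 7 else 0.
Proof.
have [->|k0] := eqVneq k 0.
  under eq_bigr do rewrite mulr0 chi0.
  by rewrite sumr_const card_ord.
have : (\sum_i chi (i * k)) * chi k = \sum_i chi (i * k).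
  rewrite [RHS](reindex_inj (addIr (1 : 'Z_7))) big_distrl /=.
  by apply: eq_bigr => i _; rewrite mulrDl mul1r chiD.
move/eqP; rewrite -subr_eq0 -[X in _ - X]mulr1 -mulrBr mulf_eq0 subr_eq0.
by rewrite chi_eq1 (negPf k0) orbF => /eqP.
Qed.

Definition dft z k := \sum_i z i * chi (- (i * k)).

Lemma dftK z i : z i = 7^-1 * \sum_k dft z k * chi (i * k).
Proof.
have -> : \sum_k dft z k * chi (i * k) = \sum_j z j * \sum_k chi (k * (i - j)).
  under eq_bigr do rewrite big_distrl /=.
  rewrite exchange_big; apply: eq_bigr => j _ /=.
  rewrite big_distrr; apply: eq_bigr => k _ /=.
  by rewrite -mulrA -chiD mulrBr addrC [i * k]mulrC [j * k]mulrC.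
rewrite (bigD1 i) //= subrr sum_chi eqxx big1 ?addr0.
  by rewrite mulrCA mulVf ?mulr1.
move=> j ji; rewrite sum_chi subr_eq0 eq_sym (negPf ji); exact: mulr0.
Qed.

Lemma idftK (A : 'Z_7 -> F) k :
  dft (fun i => \sum_l A l * chi (i * l)) k = 7 * A k.
Proof.
have -> : dft (fun i => \sum_l A l * chi (i * l)) k =
    \sum_l A l * \sum_i chi (i * (l - k)).
  rewrite /dft; under eq_bigr do rewrite big_distrl /=.
  rewrite exchange_big; apply: eq_bigr => l _ /=.
  rewrite big_distrr; apply: eq_bigr => i _ /=.
  by rewrite -mulrA -chiD mulrBr.
rewrite (bigD1 k) //= subrr sum_chi eqxx big1 ?addr0; first by rewrite mulrC.
move=> j jk; rewrite sum_chi subr_eq0 (negPf jk); exact: mulr0.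
Qed.

(** The indices are arranged so that the transforms are [A_k A_(-k)] and [A_k ^ 2 A_(-2k)],
    monomials of total index 0, which a shift of [z] leaves unchanged. *)
Definition corr2 z k := \sum_j z (k + j) * z j.
Definition corr3 z k := \sum_j \sum_l z (k - j + 2 * l) * z j * z l.

Lemma dft_corr2 z k : dft (corr2 z) k = dft z k * dft z (- k).
Proof.
rewrite /dft big_distrr /= /corr2.
under eq_bigr do rewrite big_distrl /=.
rewrite exchange_big; apply: eq_bigr => j _ /=.
rewrite big_distrl (reindex_inj (addIr (- j))) /=; apply: eq_bigr => i _.
have -> : - ((i - j) * k) = - (i * k) + - (j * - k).
  by rewrite mulrBl opprB mulrN opprK addrC.
by rewrite subrK chiD mulrACA.
Qed.

Lemma dft_corr3 z k : dft (corr3 z) k = dft z k ^+ 2 * dft z (- 2 * k).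
Proof.
rewrite expr2 -mulrA /dft /corr3.
under eq_bigr do rewrite big_distrl /=.
rewrite exchange_big mulrCA big_distrl; apply: eq_bigr => j _ /=.
under eq_bigr do rewrite big_distrl /=.
rewrite exchange_big big_distrr big_distrr; apply: eq_bigr => l _ /=.
rewrite big_distrl big_distrr (reindex_inj (addIr (j - 2 * l))) /=.
apply: eq_bigr => i _.
have -> : i + (j - 2 * l) - j + 2 * l = i.
  by rewrite [j - _]addrC addrA addrK subrK.
have -> : - ((i + (j - 2 * l)) * k) =
    - (i * k) + (- (j * k) + - (l * (- 2 * k))).
  rewrite mulrDl mulrBl opprD opprB [2 * l * k - _]addrC; congr (_ + (_ + _)).
  by rewrite mulNr mulrN opprK mulrCA mulrA.
rewrite !chiD; ring.
Qed.

(** The quotient [e] of the two transforms satisfies [e (- k) = e k ^ -1] and [e (2 k) = e k ^ 2].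
    As 2 and -1 generate the units modulo 7, [e] is determined by [e 1], a 7th root of unity, so it
    is a character, and multiplying the transform by a character shifts the function. *)
Lemma corr_shift z z' : (forall k, dft z k != 0) ->
    dft z' 0 = dft z 0 -> corr2 z' =1 corr2 z -> corr3 z' =1 corr3 z ->
  exists j, forall i, z' i = z (i + j).
Proof.
move=> nz z0 c2 c3; pose e k := dft z' k / dft z k.
have eE k : dft z' k = dft z k * e k by rewrite mulrC divfK.
have dftext f g : f =1 g -> forall k, dft f k = dft g k.
  by move=> fg k; apply: eq_bigr => i _; rewrite fg.
have e0 : e 0 = 1 by rewrite /e z0 divff.
have eN k : e k * e (- k) = 1.
  apply: (mulfI (mulf_neq0 (nz k) (nz (- k)))).
  by rewrite mulr1 -[RHS]dft_corr2 -(dftext _ _ c2) dft_corr2 !eE; ring.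
have eN2 k : e k ^+ 2 * e (- 2 * k) = 1.
  apply: (mulfI (mulf_neq0 (expf_neq0 2 (nz k)) (nz (- 2 * k)))).
  by rewrite mulr1 -[RHS]dft_corr3 -(dftext _ _ c3) dft_corr3 !eE; ring.
have e2 k : e (2 * k) = e k ^+ 2.
  rewrite -[LHS]mulr1 -(eN2 k) mulrCA mulNr eN mulr1 //.
have e17 : e 1 ^+ 7 = 1.
  have : e 1 = e 1 ^+ 8.
    (* Doubling three times is the identity modulo 7, as [8 = 1]. *)
    rewrite {1}(_ : 1 = 2 * (2 * (2 * 1))) ?e2 -?exprM //; exact/val_inj.
  have e10 : e 1 != 0 by apply: contra_eq_neq (eN 1) => ->;
    rewrite mul0r eq_sym oner_eq0.
  by rewrite exprS -{1}[e 1]mulr1 => /(mulfI e10) <-.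
have [j ej] := prim_rootP zetaP e17.
have [{}j {}ej] : exists j : 'Z_7, e 1 = chi j by exists j.
exists j => i; rewrite (dftK z') (dftK z); congr (_ * _).
apply: eq_bigr => k _; rewrite eE mulrDl chiD [e k](_ : _ = chi (j * k)).
  ring.
have chi2 l : e l = chi (j * l) -> e (2 * l) = chi (j * (2 * l)).
  by move=> el; rewrite e2 el expr2 -chiD mulr_natl mulr2n mulrDr.
have chiNN l : e l = chi (j * l) -> e (- l) = chi (j * - l).
  move=> el; have cl : chi (j * l) != 0.
    by apply: contra_eq_neq (chiN (j * l)) => ->; rewrite mulr0 eq_sym oner_eq0.
  by apply: (mulfI cl); rewrite -{1}el eN mulrN mulrC chiN.
have h1 : e 1 = chi (j * 1) by rewrite mulr1.
have h2 := chi2 _ h1; have h4 := chi2 _ h2.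
have h6 := chiNN _ h1; have h5 := chiNN _ h2; have h3 := chiNN _ h4.
have h0 : e 0 = chi (j * 0) by rewrite mulr0 chi0.
case: k => -[|[|[|[|[|[|[|//]]]]]]] kP.
- by rewrite (_ : Ordinal kP = 0) //; apply/val_inj.
- by rewrite (_ : Ordinal kP = 1) //; apply/val_inj.
- by rewrite (_ : Ordinal kP = 2 * 1) //; apply/val_inj.
- by rewrite (_ : Ordinal kP = - (2 * (2 * 1))) //; apply/val_inj.
- by rewrite (_ : Ordinal kP = 2 * (2 * 1)) //; apply/val_inj.
- by rewrite (_ : Ordinal kP = - (2 * 1)) //; apply/val_inj.
- by rewrite (_ : Ordinal kP = - 1) //; apply/val_inj.
Qed.

End Fourier.

(** * Gauss sum and real periods of the 7th roots of unity *)

Section SeventhRoot.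

Variables (R : comRingType) (x : R).
Hypothesis x0 : 1 + x + x ^+ 2 + x ^+ 3 + x ^+ 4 + x ^+ 5 + x ^+ 6 = 0.

(** Identities modulo the 7th cyclotomic polynomial are certified by their quotient [d]. *)
Let by_cert (a b d : R) :
  a - b = (1 + x + x ^+ 2 + x ^+ 3 + x ^+ 4 + x ^+ 5 + x ^+ 6) * d -> a = b.
Proof. by rewrite x0 mul0r => /eqP; rewrite subr_eq0 => /eqP. Qed.

(** The quadratic Gauss sum: 1, 2 and 4 are the squares modulo 7. *)
Let g := x + x ^+ 2 + x ^+ 4 - x ^+ 3 - x ^+ 5 - x ^+ 6.
Let c := x + x ^+ 6.

Lemma sqrtm7_sqr : g ^+ 2 = - 7.
Proof.
apply: (@by_cert _ _
  (x ^+ 6 + x ^+ 5 - 3 * x ^+ 4 + x ^+ 3 + x ^+ 2 - 7 * x + 7)).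
by rewrite /g; ring.
Qed.

Lemma real_root_cubic : c ^+ 3 + c ^+ 2 - 2 * c - 1 = 0.
Proof.
apply: (@by_cert _ _ (x ^+ 12 - x ^+ 11 + 3 * x ^+ 7 - 2 * x ^+ 6 - x ^+ 4
  + 3 * x ^+ 2 - x - 1)).
by rewrite /c; ring.
Qed.

Lemma real_root2 : x ^+ 2 + x ^+ 5 = c ^+ 2 - 2.
Proof.
apply: (@by_cert _ _ (- x ^+ 6 + x ^+ 5 - 2 * x + 2)).
by rewrite /c; ring.
Qed.

Lemma real_root4 : x ^+ 4 + x ^+ 3 = 1 - c - c ^+ 2.
Proof.
apply: (@by_cert _ _ (x ^+ 6 - x ^+ 5 + 2 * x - 1)).
by rewrite /c; ring.
Qed.

(** Inverting [x] changes the sign of both [g] and [x - x ^ 6], so they differ by a factor that is a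
    polynomial in the real period [c]. *)
Lemma imag_root1 : g * (2 * (c ^+ 2 - 2) - c - 2) = - 7 * (x - x ^+ 6).
Proof.
rewrite -real_root2.
apply: (@by_cert _ _ (x ^+ 6 - 2 * x ^+ 5 - 2 * x ^+ 4 + 6 * x ^+ 3 - 8 * x ^+ 2
  + 5 * x)).
by rewrite /g /c; ring.
Qed.

Lemma imag_root2 : g * (2 * (1 - c - c ^+ 2) - (c ^+ 2 - 2) - 2) =
  - 7 * (x ^+ 2 - x ^+ 5).
Proof.
rewrite -real_root2 -real_root4.
apply: (@by_cert _ _ (x ^+ 5 - 2 * x ^+ 4 - 4 * x ^+ 3 + 7 * x ^+ 2 - 2 * x)).
by rewrite /g; ring.
Qed.

Lemma imag_root4 : g * (2 * c - (1 - c - c ^+ 2) - 2) = - 7 * (x ^+ 4 - x ^+ 3).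
Proof.
rewrite -real_root4.
apply: (@by_cert _ _ (- 2 * x ^+ 6 + 5 * x ^+ 4 - 3 * x ^+ 3 + 2 * x ^+ 2
  - 2 * x)).
by rewrite /g /c; ring.
Qed.

End SeventhRoot.

Section CyclicCubics.

Variables (R : comRingType) (c Y1 Y2 Y4 : R).
Hypotheses (cP : c ^+ 3 + c ^+ 2 - 2 * c - 1 = 0) (Ysum : Y1 + Y2 + Y4 = 0).

Let c2 := c ^+ 2 - 2.
Let c4 := 1 - c - c ^+ 2.
(** A twist of one cyclic cubic by another: rotating [c], [c2], [c4] alone permutes the [W]s
    cyclically, while rotating them together with [Y1], [Y2], [Y4] fixes each [W]. *)
Let W1 := c * Y1 + c2 * Y2 + c4 * Y4.
Let W2 := c2 * Y1 + c4 * Y2 + c * Y4.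
Let W4 := c4 * Y1 + c * Y2 + c2 * Y4.

Let Y4E : Y4 = - Y1 - Y2.
Proof. by apply/eqP; rewrite -subr_eq0 opprD !opprK -Ysum; apply/eqP; ring. Qed.

Let by_cert (a b d : R) :
  a - b = (c ^+ 3 + c ^+ 2 - 2 * c - 1) * d -> a = b.
Proof. by rewrite cP mul0r => /eqP; rewrite subr_eq0 => /eqP. Qed.

Lemma cubic_twist_sum : W1 + W2 + W4 = 0.
Proof. by rewrite /W1 /W2 /W4 /c2 /c4 Y4E; ring. Qed.

Lemma cubic_twist_e2 :
  W1 * W2 + W2 * W4 + W4 * W1 = 7 * (Y1 * Y2 + Y2 * Y4 + Y4 * Y1).
Proof.
apply: (@by_cert _ _ (- 3 * c * Y1 ^+ 2 - 3 * c * Y1 * Y2 - 3 * c * Y2 ^+ 2)).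
by rewrite /W1 /W2 /W4 /c2 /c4 Y4E; ring.
Qed.

Lemma cubic_twist_e3 : 2 * (W1 * W2 * W4) =
  7 * (Y1 * Y2 * Y4) - 7 * ((Y1 - Y2) * (Y2 - Y4) * (Y4 - Y1)).
Proof.
apply: (@by_cert _ _ (- 4 * c ^+ 3 * Y1 ^+ 3 - 6 * c ^+ 3 * Y1 ^+ 2 * Y2
  + 6 * c ^+ 3 * Y1 * Y2 ^+ 2 + 4 * c ^+ 3 * Y2 ^+ 3 - 2 * c ^+ 2 * Y1 ^+ 3
  + 24 * c ^+ 2 * Y1 ^+ 2 * Y2 + 30 * c ^+ 2 * Y1 * Y2 ^+ 2
  + 2 * c ^+ 2 * Y2 ^+ 3 + 18 * c * Y1 ^+ 3 + 36 * c * Y1 ^+ 2 * Y2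
  - 18 * c * Y1 * Y2 ^+ 2 - 18 * c * Y2 ^+ 3 + 2 * Y1 ^+ 3 - 24 * Y1 ^+ 2 * Y2
  - 30 * Y1 * Y2 ^+ 2 - 2 * Y2 ^+ 3)).
by rewrite /W1 /W2 /W4 /c2 /c4 Y4E; ring.
Qed.

Lemma cubic_twist_disc : 2 * ((W1 - W2) * (W2 - W4) * (W4 - W1)) =
  - 189 * (Y1 * Y2 * Y4) - 7 * ((Y1 - Y2) * (Y2 - Y4) * (Y4 - Y1)).
Proof.
apply: (@by_cert _ _ (- 54 * c ^+ 3 * Y1 ^+ 2 * Y2 - 54 * c ^+ 3 * Y1 * Y2 ^+ 2
  - 54 * c ^+ 2 * Y1 ^+ 3 - 108 * c ^+ 2 * Y1 ^+ 2 * Y2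
  + 54 * c ^+ 2 * Y1 * Y2 ^+ 2 + 54 * c ^+ 2 * Y2 ^+ 3 - 18 * c * Y1 ^+ 3
  + 216 * c * Y1 ^+ 2 * Y2 + 270 * c * Y1 * Y2 ^+ 2 + 18 * c * Y2 ^+ 3
  + 54 * Y1 ^+ 3 + 108 * Y1 ^+ 2 * Y2 - 54 * Y1 * Y2 ^+ 2 - 54 * Y2 ^+ 3)).
by rewrite /W1 /W2 /W4 /c2 /c4 Y4E; ring.
Qed.

(** [D1], [D2], [D4] are the cofactors of the Gauss sum in [imag_root1], [imag_root2] and
    [imag_root4]. *)
Let D1 := 2 * c2 - c - 2.
Let D2 := 2 * c4 - c2 - 2.
Let D4 := 2 * c - c4 - 2.

Lemma cubic_twist_quad1 :
  D1 * W1 ^+ 2 + D2 * W2 ^+ 2 + D4 * W4 ^+ 2 = - 7 *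
  (2 * Y1 * Y2 - 4 * Y1 * Y4 + 2 * Y2 ^+ 2 - 2 * Y2 * Y4 + 3 * Y4 ^+ 2).
Proof.
apply: (@by_cert _ _ (3 * c ^+ 3 * Y1 ^+ 2 + 18 * c ^+ 3 * Y1 * Y2
  + 6 * c ^+ 3 * Y2 ^+ 2 + 24 * c ^+ 2 * Y1 ^+ 2 + 18 * c ^+ 2 * Y1 * Y2
  - 15 * c ^+ 2 * Y2 ^+ 2 - 20 * c * Y1 ^+ 2 - 92 * c * Y1 * Y2
  - 47 * c * Y2 ^+ 2 - 24 * Y1 ^+ 2 - 18 * Y1 * Y2 + 15 * Y2 ^+ 2)).
by rewrite /D1 /D2 /D4 /W1 /W2 /W4 /c2 /c4 Y4E; ring.
Qed.

Lemma cubic_twist_quad2 :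
  D2 * W1 ^+ 2 + D4 * W2 ^+ 2 + D1 * W4 ^+ 2 = - 7 *
  (2 * Y2 * Y4 - 4 * Y2 * Y1 + 2 * Y4 ^+ 2 - 2 * Y4 * Y1 + 3 * Y1 ^+ 2).
Proof.
apply: (@by_cert _ _ (6 * c ^+ 3 * Y1 ^+ 2 - 6 * c ^+ 3 * Y1 * Y2
  - 9 * c ^+ 3 * Y2 ^+ 2 - 15 * c ^+ 2 * Y1 ^+ 2 - 48 * c ^+ 2 * Y1 * Y2
  - 9 * c ^+ 2 * Y2 ^+ 2 - 47 * c * Y1 ^+ 2 - 2 * c * Y1 * Y2 + 25 * c * Y2 ^+ 2
  + 15 * Y1 ^+ 2 + 48 * Y1 * Y2 + 9 * Y2 ^+ 2)).
by rewrite /D1 /D2 /D4 /W1 /W2 /W4 /c2 /c4 Y4E; ring.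
Qed.

Lemma cubic_twist_quad4 :
  D4 * W1 ^+ 2 + D1 * W2 ^+ 2 + D2 * W4 ^+ 2 = - 7 *
  (2 * Y4 * Y1 - 4 * Y4 * Y2 + 2 * Y1 ^+ 2 - 2 * Y1 * Y2 + 3 * Y2 ^+ 2).
Proof.
apply: (@by_cert _ _ (- 9 * c ^+ 3 * Y1 ^+ 2 - 12 * c ^+ 3 * Y1 * Y2
  + 3 * c ^+ 3 * Y2 ^+ 2 - 9 * c ^+ 2 * Y1 ^+ 2 + 30 * c ^+ 2 * Y1 * Y2
  + 24 * c ^+ 2 * Y2 ^+ 2 + 25 * c * Y1 ^+ 2 + 52 * c * Y1 * Y2
  - 20 * c * Y2 ^+ 2 + 9 * Y1 ^+ 2 - 30 * Y1 * Y2 - 24 * Y2 ^+ 2)).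
by rewrite /D1 /D2 /D4 /W1 /W2 /W4 /c2 /c4 Y4E; ring.
Qed.

Lemma cubic_twist_inv1 : c * W1 + c2 * W2 + c4 * W4 = 7 * Y1.
Proof.
apply: (@by_cert _ _ (3 * c * Y1)).
by rewrite /W1 /W2 /W4 /c2 /c4 Y4E; ring.
Qed.

Lemma cubic_twist_inv2 : c2 * W1 + c4 * W2 + c * W4 = 7 * Y2.
Proof.
apply: (@by_cert _ _ (3 * c * Y2)).
by rewrite /W1 /W2 /W4 /c2 /c4 Y4E; ring.
Qed.

Lemma cubic_twist_inv4 : c4 * W1 + c * W2 + c2 * W4 = 7 * Y4.
Proof.
apply: (@by_cert _ _ (- 3 * c * Y1 - 3 * c * Y2)).
by rewrite /W1 /W2 /W4 /c2 /c4 Y4E; ring.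
Qed.

End CyclicCubics.

(* With [W1], [W2], [W4] the twists, by the real periods of the 7th roots of
   unity, of the differences of the roots of the cubic, the curve through
   [(q, t, W1, W2, W4)] is rational, with parameter [r]. *)
Section KummerParameter.

Variables (F : fieldType) (W1 W2 W4 q t : F).
Hypotheses (n2 : 2 != 0 :> F) (n3 : 3 != 0 :> F) (q0 : q != 0).
Hypotheses (Wsum : W1 + W2 + W4 = 0)
  (We2 : W1 * W2 + W2 * W4 + W4 * W1 = - q ^+ 2)
  (We3 : W1 * W2 * W4 = - q ^+ 2)
  (Wdisc : (W1 - W2) * (W2 - W4) * (W4 - W1) = - q ^+ 2 * (2 * t - 3)).

Lemma kummer_parameter : exists2 r : F, r = (2 * q - (W2 - W4)) / W1 &
  [/\ [/\ r != 0, r - 1 != 0, r - 3 != 0, r + 1 != 0 & r + 3 != 0],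
   r ^+ 2 + 3 != 0,
   q = (r ^+ 2 + 3) ^+ 3 / (4 * r * (r - 1) * (r - 3) * (r + 1) * (r + 3)) /\
   t = (r ^+ 6 + 6 * r ^+ 5 - 45 * r ^+ 4 - 60 * r ^+ 3 + 135 * r ^+ 2
     + 54 * r - 27) / (4 * r * (r - 1) * (r - 3) * (r + 1) * (r + 3)) &
   [/\ W1 = (r ^+ 2 + 3) ^+ 2 / ((r - 1) * (r - 3) * (r + 1) * (r + 3)),
    W2 = W1 * ((3 - r ^+ 2) / (2 * r) - 1) / 2 &
    W4 = - W1 * ((3 - r ^+ 2) / (2 * r) + 1) / 2]].
Proof.
have n4 : 4 != 0 :> F by rewrite (_ : 4 = 2 * 2) ?mulf_neq0 //; ring.
have W10 : W1 != 0.
  apply: contra_neq q0 => W10; apply/eqP; rewrite -sqrf_eq0 -oppr_eq0 -We3.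
  by rewrite W10 !mul0r.
have [h hE] : exists h, W2 - W4 = W1 * h.
  by exists ((W2 - W4) / W1); rewrite mulrC divfK.
have [v vE] : exists v, q = W1 * v by exists (q / W1); rewrite mulrC divfK.
have W2E : W2 = W1 * (h - 1) / 2.
  apply: (mulIf n2); rewrite divfK // mulrBr -hE mulr1.
  by rewrite (_ : W1 = - W2 - W4) ?[LHS]mulr_natr; [ring|];
    apply/eqP; rewrite -subr_eq0 opprB opprK -Wsum; apply/eqP; ring.
have W4E : W4 = - W1 * (h + 1) / 2.
  have -> : W4 = W2 - (W2 - W4) by ring.
  rewrite hE W2E; field; exact: n2.
have v0 : v != 0 by apply: contra_neq q0 => v0; rewrite vE v0 mulr0.
have vh : 4 * v ^+ 2 = h ^+ 2 + 3.
  apply: (mulfI (expf_neq0 2 W10)); apply: oppr_inj.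
  have -> : - (W1 ^+ 2 * (4 * v ^+ 2)) = 4 * - q ^+ 2 by rewrite vE; ring.
  by rewrite -We2 W2E W4E; field; exact: n2.
have W1h : W1 * (h ^+ 2 - 1) = 4 * v ^+ 2.
  apply: (mulfI (expf_neq0 2 W10)); apply: oppr_inj.
  have -> : - (W1 ^+ 2 * (4 * v ^+ 2)) = 4 * - q ^+ 2 by rewrite vE; ring.
  by rewrite -We3 W2E W4E; field; exact: n2.
(* The conic [4 v ^ 2 = h ^ 2 + 3] reads [(2 v - h) (2 v + h) = 3], so [r] parametrises it. Then
   [W1h] gives [W1], and [t] is found last because it enters [Wdisc] linearly. *)
pose r := 2 * v - h.
have rr : r * (2 * v + h) = 3.
  have -> : r * (2 * v + h) = 4 * v ^+ 2 - h ^+ 2 by rewrite /r; ring.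
  rewrite vh; ring.
have r0 : r != 0 by apply: contra_neq n3 => r0; rewrite -rr r0 mul0r.
have r'E : 2 * v + h = 3 / r by apply: (mulfI r0); rewrite rr mulrC divfK.
have hr : h = (3 - r ^+ 2) / (2 * r).
  apply: (mulfI n2); have -> : 2 * h = (2 * v + h) - r by rewrite /r; ring.
  by rewrite r'E; field; rewrite r0.
have vr : v = (r ^+ 2 + 3) / (4 * r).
  apply: (mulfI n4); have -> : 4 * v = (2 * v + h) + r by rewrite /r; ring.
  by rewrite r'E; field; rewrite r0 n4.
have r23 : r ^+ 2 + 3 != 0.
  by apply: contra_neq v0 => r23; rewrite vr r23 mul0r.
have hr1 : h ^+ 2 - 1 =
    ((r - 1) * (r - 3) * (r + 1) * (r + 3)) / (4 * r ^+ 2).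
  by rewrite hr; field; rewrite r0 n2 n4.
have h1 : h ^+ 2 - 1 != 0.
  apply: contra_neq v0 => h1; apply/eqP; rewrite -sqrf_eq0.
  by rewrite -(inj_eq (mulfI n4)) mulr0 -W1h h1 mulr0.
have : (r - 1) * (r - 3) * (r + 1) * (r + 3) != 0.
  by apply: contra_neq h1 => H; rewrite hr1 H mul0r.
rewrite !mulf_eq0 !negb_or => /andP [/andP [/andP [r1 r3] rm1] rm3].
have W1E : W1 = (r ^+ 2 + 3) ^+ 2 / ((r - 1) * (r - 3) * (r + 1) * (r + 3)).
  apply: (mulIf h1); rewrite W1h hr1 vr; field.
  by rewrite r0 r1 r3 rm1 rm3 n4.
have qE : q =
    (r ^+ 2 + 3) ^+ 3 / (4 * r * (r - 1) * (r - 3) * (r + 1) * (r + 3)).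
  by rewrite vE W1E vr; field; rewrite r0 r1 r3 rm1 rm3 n4.
exists r; first by rewrite hE /r vE; field; rewrite W10.
split=> //; last by split; rewrite // {1}(W2E, W4E) -hr.
split=> //; apply: (mulfI n2); apply: (addIr (- 3)).
apply: (mulfI (expf_neq0 2 q0)); apply: oppr_inj; rewrite -mulNr -Wdisc.
rewrite W2E W4E hr W1E qE; field.
by rewrite r0 r1 r3 rm1 rm3 n4 n2.
Qed.

End KummerParameter.

(* The Fourier transform of [k |-> A_k ^ 2 * A_(- 2 k)], where the [A_k] are the
   Lagrange resolvents of the septic; it lies in the sextic field. *)
Definition resolvent_coef (F : fieldType) (Y1 Y2 Y4 e : F) (k : 'Z_7) : F :=
  let Z Y1 Y2 Y4 :=
    2 * Y1 * Y2 - 4 * Y1 * Y4 + 2 * Y2 ^+ 2 - 2 * Y2 * Y4 + 3 * Y4 ^+ 2 in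
  nth 0 [:: - 7; 2 * Y1 + e * Z Y1 Y2 Y4; 2 * Y2 + e * Z Y2 Y4 Y1;
    2 * Y4 - e * Z Y4 Y1 Y2; 2 * Y4 + e * Z Y4 Y1 Y2;
    2 * Y2 - e * Z Y2 Y4 Y1; 2 * Y1 - e * Z Y1 Y2 Y4] k.

Lemma sum_Z7 (V : zmodType) (f : 'Z_7 -> V) :
  \sum_k f k = f 0 + f 1 + f 2 + f 3 + f 4 + f 5 + f 6.
Proof.
rewrite !big_ord_recl big_ord0 addr0 !addrA.
by congr (_ + _ + _ + _ + _ + _ + _); congr f; apply/val_inj.
Qed.

Lemma forall_Z7 (Q : 'Z_7 -> Prop) :
  Q 0 -> Q 1 -> Q 2 -> Q 3 -> Q 4 -> Q 5 -> Q 6 -> forall k, Q k.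
Proof.
move=> Q0 Q1 Q2 Q3 Q4 Q5 Q6 [[|[|[|[|[|[|[|//]]]]]]] kP].
- by rewrite (_ : Ordinal kP = 0) //; apply/val_inj.
- by rewrite (_ : Ordinal kP = 1) //; apply/val_inj.
- by rewrite (_ : Ordinal kP = 2) //; apply/val_inj.
- by rewrite (_ : Ordinal kP = 3) //; apply/val_inj.
- by rewrite (_ : Ordinal kP = 4) //; apply/val_inj.
- by rewrite (_ : Ordinal kP = 5) //; apply/val_inj.
- by rewrite (_ : Ordinal kP = 6) //; apply/val_inj.
Qed.

Ltac eval_chi := repeat match goal with |- context [chi ?z ?e] =>
  let n := eval vm_compute in (nat_of_ord e) in
  change (chi z e) with (z ^+ n) end.

Ltac eval_ord := repeat match goal with |- context [nat_of_ord ?e] =>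
  let n := eval vm_compute in (nat_of_ord e) in
  progress change (nat_of_ord e) with n end.

Definition combination7 (F : fieldType) (c1 c2 c4 Y1 Y2 Y4 : F) : F :=
  (c1 * Y1 + c2 * Y2 + c4 * Y4) / 7.

Definition radicand_of (F : fieldType) (r : F) : F :=
  (r + 1) ^+ 2 * (r + 3) ^+ 3 / (r * (r - 1) ^+ 3 * (r - 3) ^+ 2).

(** The value of [a ^ 7] as a formula in [zeta], the roots of the cubic and [s]: it must be
    available once [zeta] is adjoined but before [a] is, and be transported to the larger field. *)
Definition kummer_radicand (F : fieldType) (zeta y1 y2 y3 s : F) : F :=
  let c := zeta + zeta ^+ 6 in
  let g := zeta + zeta ^+ 2 + zeta ^+ 4 - zeta ^+ 3 - zeta ^+ 5 - zeta ^+ 6 in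
  let W c1 c2 c4 := combination7 c1 c2 c4 (y1 - y2) (y2 - y3) (y3 - y1) in
  let W1 := W c (c ^+ 2 - 2) (1 - c - c ^+ 2) in
  let W2 := W (c ^+ 2 - 2) (1 - c - c ^+ 2) c in
  let W4 := W (1 - c - c ^+ 2) c (c ^+ 2 - 2) in
  radicand_of ((2 * (- (s * g) / 7) - (W2 - W4)) / W1).

Lemma kummer_radicand_morph (F F' : fieldType) (f : {rmorphism F -> F'})
    (zeta y1 y2 y3 s : F) :
  f (kummer_radicand zeta y1 y2 y3 s) =
  kummer_radicand (f zeta) (f y1) (f y2) (f y3) (f s).
Proof.
have f1 : f 1 = 1 := rmorph1 f.
have f2 : f 2 = 2 := rmorph_nat f 2.
have f3 : f 3 = 3 := rmorph_nat f 3.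
have f7 : f 7 = 7 := rmorph_nat f 7.
have fX n x : f (x ^+ n) = f x ^+ n := rmorphXn f n x.
have fR r : f (radicand_of r) = radicand_of (f r).
  rewrite /radicand_of.
  by rewrite !(f1, f3, fX, fmorphV, rmorphM, rmorphB, rmorphD).
have fW c1 c2 c4 Y1 Y2 Y4 : f (combination7 c1 c2 c4 Y1 Y2 Y4) =
    combination7 (f c1) (f c2) (f c4) (f Y1) (f Y2) (f Y4).
  by rewrite /combination7 !(f7, fmorphV, rmorphM, rmorphD).
have fc : f (zeta + zeta ^+ 6) = f zeta + f zeta ^+ 6 by rewrite rmorphD fX.
have fg : f (zeta + zeta ^+ 2 + zeta ^+ 4 - zeta ^+ 3 - zeta ^+ 5 - zeta ^+ 6) =
    f zeta + f zeta ^+ 2 + f zeta ^+ 4 - f zeta ^+ 3 - f zeta ^+ 5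
    - f zeta ^+ 6.
  by rewrite !(fX, rmorphB, rmorphD).
rewrite /kummer_radicand fR fmorph_div rmorphB [f (2 * _)]rmorphM f2 fmorph_div.
rewrite f7 rmorphN rmorphM fg [f (combination7 _ _ _ _ _ _ - _)]rmorphB !fW.
by rewrite !rmorphB f2 f1 !fX !fc.
Qed.

Section Resolvents.

Variables (F : fieldType) (zeta y1 y2 y3 s t : F).
Let u := t ^+ 2 - 3 * t + 9.
Hypotheses (n2 : 2 != 0 :> F) (n3 : 3 != 0 :> F) (n7 : 7 != 0 :> F).
Hypothesis u0 : u != 0.
Hypotheses (zetaP : 7.-primitive_root zeta).
Hypotheses (y_e1 : y1 + y2 + y3 = t)
  (y_e2 : y1 * y2 + y2 * y3 + y3 * y1 = - (2 * t ^+ 2 - 7 * t + 21))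
  (y_e3 : y1 * y2 * y3 = - (t ^+ 3 + 28))
  (y_disc : (y1 - y2) * (y2 - y3) * (y3 - y1) = 7 * u * (t - 2))
  (sE : s ^+ 2 = - 7 * u).

Let Y1 := y1 - y2.
Let Y2 := y2 - y3.
Let Y4 := y3 - y1.

Let zeta_sum : 1 + zeta + zeta ^+ 2 + zeta ^+ 3 + zeta ^+ 4 + zeta ^+ 5
  + zeta ^+ 6 = 0.
Proof.
have := sum_chi zetaP 1; rewrite /= sum_Z7; eval_chi => <-.
by rewrite expr0 expr1.
Qed.

(** The roots are defined as the inverse transform of explicit resolvents. In their correlations
    [zeta] disappears, since the twists [W] are undone by the characters and the Gauss sum combines
    with [q] into [s]. *)
Lemma septic_resolvents a : a ^+ 7 = kummer_radicand zeta y1 y2 y3 s ->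
  exists z : 'Z_7 -> F, [/\ forall i, z i ^+ 7 + 7 * z i ^+ 6
      - 112 * u * z i ^+ 2 + 448 * u * z i + 64 * u * (t - 8) = 0,
    forall k, dft zeta z k != 0, dft zeta z 0 = - 7,
    corr2 z =1 fun k => if k == 0 then 49 else 0 &
    corr3 z =1 fun k => 49 * resolvent_coef Y1 Y2 Y4 (2 * s / (49 * u)) k].
Proof.
move=> aE; pose c := zeta + zeta ^+ 6.
pose g := zeta + zeta ^+ 2 + zeta ^+ 4 - zeta ^+ 3 - zeta ^+ 5 - zeta ^+ 6.
have gE : g ^+ 2 = - 7 by apply: sqrtm7_sqr.
have cE : c ^+ 3 + c ^+ 2 - 2 * c - 1 = 0 by apply: real_root_cubic.
have Ysum : Y1 + Y2 + Y4 = 0 by rewrite /Y1 /Y2 /Y4; ring.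
have Ye2 : Y1 * Y2 + Y2 * Y4 + Y4 * Y1 = - 7 * u.
  have -> : Y1 * Y2 + Y2 * Y4 + Y4 * Y1 =
    3 * (y1 * y2 + y2 * y3 + y3 * y1) - (y1 + y2 + y3) ^+ 2.
    by rewrite /Y1 /Y2 /Y4; ring.
  by rewrite y_e1 y_e2 /u; ring.
have Yd : (Y1 - Y2) * (Y2 - Y4) * (Y4 - Y1) = 7 * u * (t + 12).
  have -> : (Y1 - Y2) * (Y2 - Y4) * (Y4 - Y1) =
    (y1 + y2 + y3) ^+ 3 - 3 * (y1 + y2 + y3) * (y1 + y2 + y3) ^+ 2
    + 9 * (y1 + y2 + y3) * (y1 * y2 + y2 * y3 + y3 * y1) - 27 * (y1 * y2 * y3).
    by rewrite /Y1 /Y2 /Y4; ring.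
  by rewrite y_e1 y_e2 y_e3 /u; ring.
pose W1 := (c * Y1 + (c ^+ 2 - 2) * Y2 + (1 - c - c ^+ 2) * Y4) / 7.
pose W2 := ((c ^+ 2 - 2) * Y1 + (1 - c - c ^+ 2) * Y2 + c * Y4) / 7.
pose W4 := ((1 - c - c ^+ 2) * Y1 + c * Y2 + (c ^+ 2 - 2) * Y4) / 7.
(* A square root of [u], because [s ^ 2 = - 7 u] and [g ^ 2 = - 7]. *)
pose q := - (s * g) / 7.
have n49 : 49 != 0 :> F by rewrite (_ : 49 = 7 * 7) ?mulf_neq0 //; ring.
have n343 : 343 != 0 :> F by rewrite (_ : 343 = 7 * 49) ?mulf_neq0 //; ring.
have n14 : 2 * 7 ^+ 3 != 0 :> F by rewrite mulf_neq0 ?expf_neq0.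
have qE : q ^+ 2 = u.
  have -> : q ^+ 2 = s ^+ 2 * g ^+ 2 / 7 ^+ 2
    by rewrite /q; field; rewrite ?n7 ?n49.
  by rewrite sE gE; field; rewrite ?n7 ?n49 ?n343.
have q0 : q != 0 by rewrite -sqrf_eq0 qE.
have Wsum : W1 + W2 + W4 = 0.
  by rewrite /W1 /W2 /W4 -!mulrDl cubic_twist_sum // mul0r.
have We2 : W1 * W2 + W2 * W4 + W4 * W1 = - q ^+ 2.
  apply: (mulfI (expf_neq0 2 n7)); rewrite qE.
  have -> : 7 ^+ 2 * - u = 7 * (- 7 * u) by ring.
  by rewrite -Ye2 -(cubic_twist_e2 cE Ysum) /W1 /W2 /W4; field;
    rewrite ?n7 ?n49 ?n343.
have We3 : W1 * W2 * W4 = - q ^+ 2.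
  apply: (mulfI n14); rewrite qE.
  have -> : 2 * 7 ^+ 3 * - u = 7 * (7 * u * (t - 2)) - 7 * (7 * u * (t + 12)).
    by ring.
  by rewrite -Yd -y_disc -(cubic_twist_e3 cE Ysum) /W1 /W2 /W4; field;
    rewrite ?n7 ?n49 ?n343.
have Wdisc : (W1 - W2) * (W2 - W4) * (W4 - W1) = - q ^+ 2 * (2 * t - 3).
  apply: (mulfI n14); rewrite qE.
  have -> : 2 * 7 ^+ 3 * (- u * (2 * t - 3)) =
    - 189 * (7 * u * (t - 2)) - 7 * (7 * u * (t + 12)) by ring.
  by rewrite -Yd -y_disc -(cubic_twist_disc cE Ysum) /W1 /W2 /W4; field;
    rewrite ?n7 ?n49 ?n343.
have [r rE [[r0 r1 r3 rm1 rm3] r23 [qr tr] [W1r W2r W4r]]] :=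
  kummer_parameter n2 n3 q0 Wsum We2 We3 Wdisc.
have n4 : 4 != 0 :> F by rewrite (_ : 4 = 2 * 2) ?mulf_neq0 //; ring.
have {}aE : a ^+ 7 =
    (r + 1) ^+ 2 * (r + 3) ^+ 3 / (r * (r - 1) ^+ 3 * (r - 3) ^+ 2).
  by rewrite aE rE.
have a0 : a != 0.
  have : a ^+ 7 != 0.
    by rewrite aE !mulf_neq0 ?invr_neq0 ?mulf_neq0 ?expf_neq0.
  by rewrite expf_eq0.
pose ka := (r - 1) * (r - 3) / ((r + 1) * (r + 3)).
pose la := r * (r - 1) ^+ 2 * (r - 3) / ((r + 1) * (r + 3) ^+ 2).
(* These are the terms of [kummer_sum]. The signs and coefficients make the products of opposite
   terms all equal to [ka la a ^ 7], which is 1. *)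
pose A (k : 'Z_7) := nth 0 [:: - 1; a; ka * a ^+ 2; - ka * a ^+ 3;
  - la * a ^+ 4; la * a ^+ 5; ka * la * a ^+ 6] k.
pose z i := \sum_l A l * chi zeta (i * l).
have chi7 i : chi zeta i ^+ 7 = 1.
  by rewrite /chi exprAC (prim_expr_order zetaP) expr1n.
(* The seven roots come from the seven choices of the seventh root [a]. *)
have zE i : z i = kummer_sum r (a * chi zeta i).
  rewrite /z sum_Z7 /kummer_sum /pol7 /A /=.
  have chiM l : chi zeta (i * l) = chi zeta i ^+ l.
    by rewrite -[in LHS](natr_Zp l) mulr_natr Zp_mulrn /chi /=
      (prim_expr_mod zetaP)
      exprM.
  rewrite !chiM; eval_ord; rewrite /= /ka /la; field; by rewrite rm1 rm3.
have dE k : dft zeta z k = 7 * A k by apply: idftK.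
have A0 k : A k != 0.
  move: k; apply: forall_Z7; rewrite /A /= ?oppr_eq0 ?oner_eq0 //.
  1-5: rewrite /ka /la ?mulNr ?oppr_eq0 ?mulf_neq0 ?invr_neq0 ?mulf_neq0
    ?expf_neq0 //.
have kl : ka * la * a ^+ 7 = 1.
  rewrite aE /ka /la; field.
  by rewrite r0 r1 r3 rm1 rm3.
have AN k : A k * A (- k) = 1.
  move: k; apply: forall_Z7; first by rewrite oppr0 /A /= mulrNN mulr1.
  1-6: by apply: (etrans _ kl); rewrite /A; eval_ord; rewrite /=; ring.
have W2r' := W2r; have W4r' := W4r; rewrite W1r in W2r' W4r'.
pose e := 2 / q.
(* The monomials [A_k ^ 2 A_(-2k)], split into a part even in [k], linear in the [W]s, and an odd
   part, quadratic in them. *)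
pose m (k : 'Z_7) := nth 0 [:: - 1; 2 * W1 - 1 + e * W1 ^+ 2;
  2 * W2 - 1 + e * W2 ^+ 2; 2 * W4 - 1 - e * W4 ^+ 2; 2 * W4 - 1 + e * W4 ^+ 2;
  2 * W2 - 1 - e * W2 ^+ 2; 2 * W1 - 1 - e * W1 ^+ 2] k.
have a7' : a ^+ 7 = (ka * la)^-1.
  apply: (mulfI (_ : ka * la != 0)); last first.
    by rewrite kl mulfV //; apply: contra_eq_neq kl => ->;
      rewrite mul0r eq_sym oner_eq0.
  by apply: contra_eq_neq kl => ->; rewrite mul0r eq_sym oner_eq0.
have qe : e * q = 2 by rewrite /e divfK.
have mE : [/\ m 1 = ka^-1, m 2 = - (ka ^+ 2 / la), m 4 = la / ka,
    m 6 = ka & m 5 = - (la / ka ^+ 2) /\ m 3 = ka / la].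
  rewrite /m /e; eval_ord; rewrite /= W2r' W4r' W1r qr /ka /la.
  by do !split; field; rewrite ?r0 ?r1 ?r3 ?rm1 ?rm3 ?n2 ?n4 ?r23.
have [ka0 la0] : ka != 0 /\ la != 0.
  have : ka * la != 0.
    by apply: contra_eq_neq kl => ->; rewrite mul0r eq_sym oner_eq0.
  by rewrite mulf_eq0 negb_or => /andP.
have a7l : a ^+ 7 = (ka * la)^-1.
  by apply: (mulfI (mulf_neq0 ka0 la0)); rewrite kl (mulfV (mulf_neq0 ka0 la0)).
have Am k : A k ^+ 2 * A (- 2 * k) = m k.
  have [m1 m2 m4 m6 [m5 m3]] := mE.
  move: k; apply: forall_Z7; rewrite ?m1 ?m2 ?m3 ?m4 ?m5 ?m6 /A.
  - rewrite mulr0 /m /=; ring.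
  - eval_ord; rewrite /= [LHS](_ : _ = la * a ^+ 7); last by ring.
    by rewrite a7l; field; rewrite ka0 la0.
  - eval_ord; rewrite /= [LHS](_ : _ = - ka ^+ 3 * a ^+ 7); last by ring.
    by rewrite a7l; field; rewrite ka0 la0.
  - eval_ord; rewrite /= [LHS](_ : _ = ka ^+ 2 * a ^+ 7); last by ring.
    by rewrite a7l; field; rewrite ka0 la0.
  - eval_ord; rewrite /= [LHS](_ : _ = ka * la ^+ 3 * (a ^+ 7) ^+ 2);
    last by ring.
    by rewrite a7l; field; rewrite ka0 la0.
  - eval_ord; rewrite /= [LHS](_ : _ = - la ^+ 3 * (a ^+ 7) ^+ 2); last by ring.
    by rewrite a7l; field; rewrite ka0 la0.
  - eval_ord; rewrite /= [LHS](_ : _ = ka ^+ 3 * la ^+ 2 * (a ^+ 7) ^+ 2);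
    last by ring.
    by rewrite a7l; field; rewrite ka0 la0.
exists z; split=> //.
- move=> i; rewrite zE -qE qr tr; apply: kummer_sum_root => //.
  by rewrite exprMn chi7 mulr1.
- by move=> k; rewrite dE mulf_neq0.
- by rewrite dE /A /= mulrN mulr1.
- move=> k; rewrite (dftK n7 zetaP (corr2 z)).
  under eq_bigr => l _ do rewrite dft_corr2 // !dE mulrACA AN mulr1 mulrC
    [k * l]mulrC.
  rewrite -mulr_suml sum_chi //; case: (k == 0); last by rewrite mul0r mulr0.
  by rewrite mulKf; [ring|].
move=> k; rewrite (dftK n7 zetaP (corr3 z)).
have -> : \sum_l dft zeta (corr3 z) l * chi zeta (k * l) =
    7 ^+ 3 * \sum_l m l * chi zeta (k * l).
  rewrite big_distrr; apply: eq_bigr => l _ /=.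
  rewrite dft_corr3 // !dE -Am; ring.
rewrite [LHS](_ : _ = 49 * \sum_l m l * chi zeta (k * l)); last first.
  by apply: (mulfI n7); rewrite mulVKf //; ring.
congr (_ * _).
(* The denominator [q] of [e] is a multiple of [s g], so the Gauss sum produced by the odd part
   leaves only [s]. *)
have eg : - (e * g) / 7 = - 2 * s / (7 * u).
  have g0 : g != 0 by apply: contraNneq q0 => g0;
    rewrite /q g0 mulr0 oppr0 mul0r.
  have s0 : s != 0 by apply: contraNneq q0 => s0;
    rewrite /q s0 mul0r oppr0 mul0r.
  have -> : u = - s ^+ 2 / 7 by rewrite sE; field; rewrite n7.
  by rewrite /e /q; field; rewrite n7 !oppr_eq0 expf_neq0 ?mulf_neq0.
have dE1 : zeta - zeta ^+ 6 = - (g * (2 * (c ^+ 2 - 2) - c - 2)) / 7.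
  by rewrite (imag_root1 zeta_sum); field; rewrite n7.
have dE2 : zeta ^+ 2 - zeta ^+ 5 =
    - (g * (2 * (1 - c - c ^+ 2) - (c ^+ 2 - 2) - 2)) / 7.
  by rewrite (imag_root2 zeta_sum); field; rewrite n7.
have dE4 : zeta ^+ 4 - zeta ^+ 3 = - (g * (2 * c - (1 - c - c ^+ 2) - 2)) / 7.
  by rewrite (imag_root4 zeta_sum); field; rewrite n7.
have re1 : zeta + zeta ^+ 6 = c by [].
have re2 : zeta ^+ 2 + zeta ^+ 5 = c ^+ 2 - 2 := real_root2 zeta_sum.
have re4 : zeta ^+ 4 + zeta ^+ 3 = 1 - c - c ^+ 2 := real_root4 zeta_sum.
have YE1 : (zeta + zeta ^+ 6) * W1 + (zeta ^+ 2 + zeta ^+ 5) * W2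
    + (zeta ^+ 4 + zeta ^+ 3) * W4 = Y1.
  apply: (mulfI n49); rewrite [RHS](_ : _ = 7 * (7 * Y1)); last by ring.
  rewrite re1 re2 re4 -(cubic_twist_inv1 cE Ysum) /W1 /W2 /W4.
  by field; rewrite n7.
have YE2 : (zeta ^+ 2 + zeta ^+ 5) * W1 + (zeta ^+ 4 + zeta ^+ 3) * W2
    + (zeta + zeta ^+ 6) * W4 = Y2.
  apply: (mulfI n49); rewrite [RHS](_ : _ = 7 * (7 * Y2)); last by ring.
  rewrite re1 re2 re4 -(cubic_twist_inv2 cE Ysum) /W1 /W2 /W4.
  by field; rewrite n7.
have YE4 : (zeta ^+ 4 + zeta ^+ 3) * W1 + (zeta + zeta ^+ 6) * W2
    + (zeta ^+ 2 + zeta ^+ 5) * W4 = Y4.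
  apply: (mulfI n49); rewrite [RHS](_ : _ = 7 * (7 * Y4)); last by ring.
  rewrite re1 re2 re4 -(cubic_twist_inv4 cE Ysum) /W1 /W2 /W4.
  by field; rewrite n7.
pose Z Y1 Y2 Y4 : F :=
  2 * Y1 * Y2 - 4 * Y1 * Y4 + 2 * Y2 ^+ 2 - 2 * Y2 * Y4 + 3 * Y4 ^+ 2.
have ZE (d1 d2 d4 D1 D2 D4 Zv : F) :
    d1 = - (g * D1) / 7 -> d2 = - (g * D2) / 7 -> d4 = - (g * D4) / 7 ->
    D1 * (7 * W1) ^+ 2 + D2 * (7 * W2) ^+ 2 + D4 * (7 * W4) ^+ 2 = - 7 * Zv ->
  e * (d1 * W1 ^+ 2 + d2 * W2 ^+ 2 + d4 * W4 ^+ 2) = 2 * s / (49 * u) * Zv.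
  move=> -> -> -> Zz.
  have -> : e * (- (g * D1) / 7 * W1 ^+ 2 + - (g * D2) / 7 * W2 ^+ 2
      + - (g * D4) / 7 * W4 ^+ 2) = - (e * g) / 7 / 49 *
      (D1 * (7 * W1) ^+ 2 + D2 * (7 * W2) ^+ 2 + D4 * (7 * W4) ^+ 2).
    by field; rewrite ?n7 ?n49 ?n343.
  by rewrite Zz eg; field; rewrite ?u0 ?n7 ?n49 ?n343.
have [W1c W2c W4c] :
   [/\ 7 * W1 = c * Y1 + (c ^+ 2 - 2) * Y2 + (1 - c - c ^+ 2) * Y4,
    7 * W2 = (c ^+ 2 - 2) * Y1 + (1 - c - c ^+ 2) * Y2 + c * Y4 &
    7 * W4 = (1 - c - c ^+ 2) * Y1 + c * Y2 + (c ^+ 2 - 2) * Y4].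
  by split; rewrite mulrC divfK.
have ZE1 : e * ((zeta - zeta ^+ 6) * W1 ^+ 2 + (zeta ^+ 2 - zeta ^+ 5) * W2 ^+ 2
    + (zeta ^+ 4 - zeta ^+ 3) * W4 ^+ 2) = 2 * s / (49 * u) * Z Y1 Y2 Y4.
  apply: (ZE _ _ _ _ _ _ _ dE1 dE2 dE4).
  by rewrite W1c W2c W4c (cubic_twist_quad1 cE Ysum).
have ZE2 : e * ((zeta ^+ 2 - zeta ^+ 5) * W1 ^+ 2
    + (zeta ^+ 4 - zeta ^+ 3) * W2 ^+ 2 + (zeta - zeta ^+ 6) * W4 ^+ 2) =
    2 * s / (49 * u) * Z Y2 Y4 Y1.
  apply: (ZE _ _ _ _ _ _ _ dE2 dE4 dE1).
  by rewrite W1c W2c W4c (cubic_twist_quad2 cE Ysum).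
have ZE4 : e * ((zeta ^+ 4 - zeta ^+ 3) * W1 ^+ 2 + (zeta - zeta ^+ 6) * W2 ^+ 2
    + (zeta ^+ 2 - zeta ^+ 5) * W4 ^+ 2) = 2 * s / (49 * u) * Z Y4 Y1 Y2.
  apply: (ZE _ _ _ _ _ _ _ dE4 dE1 dE2).
  by rewrite W1c W2c W4c (cubic_twist_quad4 cE Ysum).
(* For nonzero [k], the even part of [m] gives [2 Y], the odd part gives the multiple of [Z], and
   the constants -1 add up to 0 by [zeta_sum]. *)
rewrite sum_Z7 /m /resolvent_coef; eval_ord; rewrite /=; move: k.
apply: forall_Z7; eval_ord; rewrite -/(Z _ _ _) -/(Z Y2 Y4 Y1)
  -/(Z Y4 Y1 Y2) /=.
- eval_chi; rewrite expr0 [LHS](_ : _ = - 7 + 4 * (W1 + W2 + W4)); last by ring.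
  by rewrite Wsum mulr0 addr0.
- eval_chi; rewrite -ZE1 -{1}YE1 -[LHS]addr0 -[X in _ + X]zeta_sum; ring.
- eval_chi; rewrite -ZE2 -{1}YE2 -[LHS]addr0 -[X in _ + X]zeta_sum; ring.
- eval_chi; rewrite -ZE4 -{1}YE4 -[LHS]addr0 -[X in _ + X]zeta_sum; ring.
- eval_chi; rewrite -ZE4 -{1}YE4 -[LHS]addr0 -[X in _ + X]zeta_sum; ring.
- eval_chi; rewrite -ZE2 -{1}YE2 -[LHS]addr0 -[X in _ + X]zeta_sum; ring.
- eval_chi; rewrite -ZE1 -{1}YE1 -[LHS]addr0 -[X in _ + X]zeta_sum; ring.
Qed.

End Resolvents.

(** * Galois groups of the cubic and of the septic *)

Section Irreducible.

Variable L : fieldExtType rat.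
Local Notation "p ^%" := (map_poly (in_alg L) p) (at level 2, format "p ^%").

Lemma irreducible_common_root (p q : {poly rat}) (x : L) :
  irreducible_poly p -> root p^% x -> q != 0 -> (size q < size p)%N ->
  ~~ root q^% x.
Proof.
move=> irrp px q0 ltqp; apply/negP => qx.
have : root (gcdp p q)^% x by rewrite gcdp_map root_gcd px.
have [g1|gp] := irredp_XsubCP irrp (dvdp_gcdl p q).
  have /size_poly1P [c c0 ->] : size (gcdp p q) == 1 by rewrite size_poly_eq1.
  by rewrite map_polyC rootC fmorph_eq0 (negPf c0).
suff /(dvdp_leq q0) : p %| q by rewrite leqNgt ltqp.
by rewrite -(eqp_dvdl _ gp) dvdp_gcdr.
Qed.

Lemma adjoin_degree_irreducible (p : {poly rat}) (x : L) :
  irreducible_poly p -> root p^% x -> (adjoin_degree 1%AS x).+1 = size p.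
Proof.
move=> irrp px; rewrite -size_minPoly; apply/eqP; rewrite eqn_leq.
have p0 := irredp_neq0 irrp.
rewrite -{1}(size_map_poly (in_alg L) p) dvdp_leq ?map_poly_eq0 //=; last first.
  by apply: minPoly_dvdp => //; apply/polyOver1P; exists p.
have /polyOver1P [q qE] := minPolyOver 1%AS x.
rewrite qE size_map_poly leqNgt; apply/negP => ltqp.
have q0 : q != 0.
  by rewrite -(map_poly_eq0 (in_alg L)) -qE monic_neq0 // monic_minPoly.
by have := irreducible_common_root irrp px q0 ltqp; rewrite -qE root_minPoly.
Qed.

End Irreducible.

Lemma cubic_size t : size (cubic t) = 4.
Proof.
rewrite /cubic -!addrA size_polyDl size_polyXn // ltnS.
rewrite (leq_trans (size_polyD _ _)) // geq_max size_polyN.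
rewrite (leq_trans (size_scale_leq _ _)) ?size_polyXn //=.
rewrite (leq_trans (size_polyD _ _)) // geq_max size_polyN.
by rewrite (leq_trans (size_scale_leq _ _)) ?size_polyX //
  (leq_trans (size_polyC_leq1 _)).
Qed.

Lemma cubic_root (L : fieldExtType rat) (t : int) (y : L) (T : L := t%:~R) :
  root (map_poly (in_alg L) (cubic t)) y =
  (y ^+ 3 - T * y ^+ 2 - (2 * T ^+ 2 - 7 * T + 21) * y + (T ^+ 3 + 28) == 0).
Proof.
rewrite /root /cubic.
move bE: (2 * t ^+ 2 - 7 * t + 21) => b.
move cE: (t ^+ 3 + 28) => c.
rewrite rmorphD !rmorphB /= !map_polyZ /= map_polyC /= !map_polyXn map_polyX.
rewrite !(hornerD, hornerN, hornerZ, hornerXn, hornerX, hornerC) -!in_algE.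
rewrite !rmorph_int -bE -cE; congr (_ == 0); rewrite /T; ring.
Qed.

Section Septic.

Variable d : nat -> rat.
Let p := 'X^7 - d 5 *: 'X^5 + d 4 *: 'X^4 - d 3 *: 'X^3 - d 2 *: 'X^2
  + d 1 *: 'X + (d 0)%:P.

Lemma size_monic7 : size p = 8.
Proof.
rewrite /p -!addrA size_polyDl size_polyXn // ltnS.
do 4![rewrite (leq_trans (size_polyD _ _)) // geq_max ?size_polyN
  (leq_trans (size_scale_leq _ _)) ?size_polyXn //=].
rewrite (leq_trans (size_polyD _ _)) // geq_max (leq_trans (size_scale_leq _ _))
  ?size_polyX // (leq_trans (size_polyC_leq1 _)) //.
Qed.

Lemma horner_monic7 (R : fieldType) (g : {rmorphism rat -> R}) (x : R)
    (e := g \o d) :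
  (map_poly g p).[x] = x ^+ 7 - e 5 * x ^+ 5 + e 4 * x ^+ 4
    - e 3 * x ^+ 3 - e 2 * x ^+ 2 + e 1 * x + e 0.
Proof.
rewrite /p !(rmorphD, rmorphN) /= !map_polyZ /= map_polyC /=.
rewrite !map_polyXn map_polyX.
by rewrite !(hornerD, hornerN, hornerZ, hornerXn, hornerX, hornerC).
Qed.

End Septic.

Definition int_septic (a b c : int) : {poly rat} :=
  'X^7 - 21 *: 'X^5 + 70 *: 'X^4 - 105 *: 'X^3 - a%:~R *: 'X^2 + b%:~R *: 'X
  + (c%:~R)%:P.

Lemma int_septic_size a b c : size (int_septic a b c) = 8.
Proof.
exact: (size_monic7 (nth 0 [:: c%:~R; b%:~R; a%:~R; 105; 70; 21])).
Qed.

Lemma int_septic_horner a b c (R : fieldType) (g : {rmorphism rat -> R})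
    (x : R) :
  (map_poly g (int_septic a b c)).[x] = x ^+ 7 - 21 * x ^+ 5
    + 70 * x ^+ 4 - 105 * x ^+ 3 - a%:~R * x ^+ 2 + b%:~R * x + c%:~R.
Proof.
rewrite (horner_monic7 (nth 0 [:: c%:~R; b%:~R; a%:~R; 105; 70; 21])).
congr (_ - _ * _ + _ * _ - _ * _ - _ * _ + _ * _ + _) => /=.
- exact: (rmorph_nat g 21).
- exact: (rmorph_nat g 70).
- exact: (rmorph_nat g 105).
- exact: (rmorph_int g a).
- exact: (rmorph_int g b).
- exact: (rmorph_int g c).
Qed.

Lemma septic_size t : size (septic t) = 8.
Proof. exact: int_septic_size. Qed.

Lemma septic_horner (R : fieldType) (g : {rmorphism rat -> R}) (t : int)
    (z : R) (T : R := t%:~R) (u := T ^+ 2 - 3 * T + 9) :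
  (map_poly g (septic t)).[z + 1] =
  z ^+ 7 + 7 * z ^+ 6 - 112 * u * z ^+ 2 + 448 * u * z + 64 * u * (T - 8).
Proof.
rewrite [LHS]int_septic_horner /u /T.
ring.
Qed.

(** * Auxiliary extensions and the cyclic cubic *)

Lemma exists_root_extension (F : fieldType) (p : {poly F}) : (1 < size p)%N ->
  exists (F' : fieldType) (f : {rmorphism F -> F'}) (x : F'),
    root (map_poly f p) x.
Proof.
have [n] := ubnP (size p); elim: n p => // n IH p; rewrite ltnS => pn p1.
have [irrp|] := classic (irreducible_poly p).
  have [F' _ [x px _]] := irredp_FAdjoin irrp.
  by exists F', (in_alg F'), x.
move=> redp; have p0 : p != 0 by rewrite -size_poly_gt0 ltnW.
have [q [q1 qp nq]] : exists q : {poly F},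
    [/\ size q != 1%N, q %| p & ~~ (q %= p)].
  apply: NNPP => H; apply: redp; split=> // q q1 qp; apply: contraT => nq.
  by case: H; exists q.
have q0 : q != 0 by apply: contraTneq qp => ->; rewrite dvd0p.
have q_gt1 : (1 < size q)%N by rewrite ltn_neqAle eq_sym q1 size_poly_gt0.
have [|F' [f [x qx]]] := IH q _ q_gt1.
  apply: leq_trans pn; rewrite ltn_neqAle dvdp_leq // andbT.
  by apply: contra nq => /eqP sz; rewrite -dvdp_size_eqp ?sz.
by exists F', f, x; apply: root_dvdp qx; rewrite dvdp_map.
Qed.

Lemma exists_primitive_root7 (F : fieldType) : 7 != 0 :> F ->
  exists (F' : fieldType) (f : {rmorphism F -> F'}) (x : F'),
    7.-primitive_root x.
Proof.
move=> n7; pose p := \poly_(i < 7) (1 : F).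
have sz : size p = 7 by rewrite size_poly_eq // oner_eq0.
have [|F' [f [x]]] := @exists_root_extension F p; first by rewrite sz.
rewrite /root (@horner_coef_wide _ 7) ?size_map_poly ?sz //.
under eq_bigr => i _ do rewrite coef_map coef_poly ltn_ord /= rmorph1 mul1r.
move=> /eqP x0; exists F', f, x.
have x7 : x ^+ 7 = 1.
  by apply/eqP; rewrite -subr_eq0 subrX1 x0 mulr0.
have [m xm m7] := prim_order_exists (isT : (0 < 7)%N) x7.
have /primeP [_ /(_ m m7) /pred2P [m1|<- //]] : prime 7 by [].
have x1 := prim_expr_order xm; rewrite m1 expr1 in x1; move: x0.
rewrite x1 (eq_bigr (fun=> 1)); last by move=> i _; rewrite expr1n.
rewrite sumr_const card_ord => /eqP.
by rewrite -(rmorph_nat f) fmorph_eq0 (negPf n7).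
Qed.

(* The other two roots are recovered from the square root [7 u (t - 2)] of the
   discriminant, their sum and the derivative at [y]. *)
Lemma cubic_conjugates (L : fieldExtType rat) (t : int) (y : L) (T : L := t%:~R)
    (u := T ^+ 2 - 3 * T + 9) :
  irreducible_poly (cubic t) -> root (map_poly (in_alg L) (cubic t)) y ->
  exists2 y23 : L * L, y23.1 \in <<1; y>>%VS /\ y23.2 \in <<1; y>>%VS &
    [/\ y + y23.1 + y23.2 = T,
      y * y23.1 + y23.1 * y23.2 + y23.2 * y = - (2 * T ^+ 2 - 7 * T + 21),
      y * y23.1 * y23.2 = - (T ^+ 3 + 28) &
      (y - y23.1) * (y23.1 - y23.2) * (y23.2 - y) = 7 * u * (T - 2)].
Proof.
move=> irr rooty.
have yE : y ^+ 3 - T * y ^+ 2 - (2 * T ^+ 2 - 7 * T + 21) * y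
    + (T ^+ 3 + 28) = 0.
  by apply/eqP; rewrite -cubic_root.
pose d := 3 * y ^+ 2 - 2 * T * y - (2 * T ^+ 2 - 7 * T + 21).
have d0 : d != 0.
  pose b := 2 * t ^+ 2 - 7 * t + 21.
  pose q : {poly rat} := 3 *: 'X^2 - ((2 * t)%:~R *: 'X + b%:~R%:P).
  have szq : size q = 3.
    rewrite size_polyDl size_scale ?size_polyXn ?size_polyN //.
    rewrite (leq_ltn_trans (size_polyD _ _)) // gtn_max.
    rewrite (leq_ltn_trans (size_scale_leq _ _)) ?size_polyX //=.
    by rewrite (leq_ltn_trans (size_polyC_leq1 _)).
  have q0 : q != 0 by rewrite -size_poly_gt0 szq.
  have := irreducible_common_root irr rooty q0; rewrite szq cubic_size.
  move=> /(_ isT); apply: contra => /eqP dE; rewrite /root.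
  rewrite rmorphB rmorphD /= !map_polyZ map_polyC /= map_polyXn map_polyX.
  rewrite !(hornerD, hornerN, hornerZ, hornerXn, hornerX, hornerC).
  rewrite -!in_algE (rmorph_nat (in_alg L) 3) (rmorph_int (in_alg L) (2 * t)).
  rewrite (rmorph_int (in_alg L) b); apply/eqP; rewrite -dE /d /b /T; ring.
have n2 : 2 != 0 :> L by rewrite -(rmorph_nat (in_alg L)) fmorph_eq0.
pose D := 7 * u * (T - 2).
(* The discriminant of the cubic is the square of its derivative at [y] times the discriminant of
   the quadratic satisfied by the other two roots. This holds modulo the equation of [y], with the
   cofactor displayed below. *)
have dd : D ^+ 2 = d ^+ 2 *
    ((T - y) ^+ 2 - 4 * (- (2 * T ^+ 2 - 7 * T + 21) - y * (T - y))).
  apply/eqP; rewrite eq_sym -subr_eq0; apply/eqP.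
  rewrite -[RHS](mul0r (- 27 * y ^+ 3 + 27 * T * y ^+ 2 + 54 * T ^+ 2 * y
    - 189 * T * y + 567 * y - 13 * T ^+ 3 + 126 * T ^+ 2 - 378 * T + 756)).
  by rewrite -yE /D /d /u; ring.
pose y2 := (T - y - D / d) / 2; pose y3 := (T - y + D / d) / 2.
have Ty (n : int) : n%:~R \in <<1; y>>%VS by rewrite -mulrzl rpredM ?rpredMz
  ?rpred1.
have yy := memv_adjoin 1%AS y.
have n4 : 4 != 0 :> L by rewrite -(rmorph_nat (in_alg L)) fmorph_eq0.
have e1 : y + y2 + y3 = T by rewrite /y2 /y3; field; rewrite d0 n2.
have y23 : y2 * y3 = - (2 * T ^+ 2 - 7 * T + 21) - y * (T - y).
  have -> : y2 * y3 = ((T - y) ^+ 2 - D ^+ 2 / d ^+ 2) / 4.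
    by rewrite /y2 /y3; field; rewrite ?d0 ?n2 ?n4.
  by rewrite dd; field; rewrite ?d0 ?n4.
exists (y2, y3) => /=.
  have DK : D / d \in <<1; y>>%VS.
    apply: rpred_div; rewrite /D /d /u /T;
      by rewrite ?(rpredM, rpredB, rpredD, rpredX, rpred_nat, rpred1, Ty, yy).
  by split; apply: rpred_div;
    rewrite ?(rpredB, rpredD, rpred_nat, rpred1, yy, Ty).
split=> //.
- have -> : y * y2 + y2 * y3 + y3 * y = y * (y2 + y3) + y2 * y3 by ring.
  have -> : y2 + y3 = T - y by rewrite -e1; ring.
  by rewrite y23; ring.
- by rewrite -mulrA y23 -[RHS]addr0 -yE; ring.
have -> : (y - y2) * (y2 - y3) * (y3 - y) =
    (y * (y2 + y3) - y ^+ 2 - y2 * y3) * (y2 - y3) by ring.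
have -> : y2 + y3 = T - y by rewrite -e1; ring.
have -> : y2 - y3 = - (D / d) by rewrite /y2 /y3; field; rewrite d0 n2.
rewrite y23 -/D; have -> : y * (T - y) - y ^+ 2 -
  (- (2 * T ^+ 2 - 7 * T + 21) - y * (T - y)) = - d by rewrite /d; ring.
by field.
Qed.

Lemma quad_neq0 (F : fieldType) (f : {rmorphism rat -> F}) (t : int) :
  (t%:~R : F) ^+ 2 - 3 * t%:~R + 9 != 0.
Proof.
have -> : (t%:~R : F) ^+ 2 - 3 * t%:~R + 9 = f (t ^+ 2 - 3 * t + 9)%:~R.
  by rewrite (rmorph_int f); ring.
rewrite fmorph_eq0 intr_eq0 gt_eqF //; nia.
Qed.

Lemma cubic_extension_cyclic (L : splittingFieldType rat) (t : int) (y : L) :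
  irreducible_poly (cubic t) -> root (map_poly (in_alg L) (cubic t)) y ->
  cyclic_extension 1%AS <<1; y>>%AS.
Proof.
move=> irr rooty.
have [[y2 y3] /= [yy2 yy3] [e1 e2 e3 disc]] := cubic_conjugates irr rooty.
have yE : y ^+ 3 - t%:~R * y ^+ 2 - (2 * t%:~R ^+ 2 - 7 * t%:~R + 21) * y +
    (t%:~R ^+ 3 + 28) = 0 by apply/eqP; rewrite -cubic_root.
have pE : map_poly (in_alg L) (cubic t) =
    \prod_(z <- [:: y; y2; y3]) ('X - z%:P).
  have -> : map_poly (in_alg L) (cubic t) = 'X^3 - (t%:~R : L)%:P * 'X^2
    - (2 * t%:~R ^+ 2 - 7 * t%:~R + 21 : L)%:P * 'X + (t%:~R ^+ 3 + 28 : L)%:P.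
    rewrite /cubic.
    move bE: (2 * t ^+ 2 - 7 * t + 21) => b.
    move cE: (t ^+ 3 + 28) => c.
    rewrite rmorphD !rmorphB /= !map_polyZ /= map_polyC /= !map_polyXn
      map_polyX.
    rewrite -!in_algE !rmorph_int -bE -cE -!mul_polyC.
    by ring.
  rewrite !big_cons big_nil mulr1 -e1.
  have -> : 2 * (y + y2 + y3) ^+ 2 - 7 * (y + y2 + y3) + 21 =
      - (y * y2 + y2 * y3 + y3 * y) by rewrite e2 e1 opprK.
  have -> : (y + y2 + y3) ^+ 3 + 28 = - (y * y2 * y3) by rewrite e3 e1 opprK.
  ring.
have un : uniq [:: y; y2; y3].
  have nz : (y - y2) * (y2 - y3) * (y3 - y) != 0.
    rewrite disc mulf_neq0 //.
      by rewrite mulf_neq0 ?(quad_neq0 (in_alg L)) //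
        -(rmorph_nat (in_alg L)) fmorph_eq0.
    (* The discriminant vanishes only for [t = 2], where the cubic has the rational root -4 and is
       reducible. *)
    rewrite subr_eq0; apply/eqP => t2.
    pose q : {poly rat} := 'X + 4%:P.
    have szq : size q = 2 by rewrite size_XaddC.
    have q0 : q != 0 by rewrite -size_poly_gt0 szq.
    have r4 : root (map_poly (in_alg L) (cubic t)) (- 4).
      by rewrite cubic_root t2; apply/eqP; ring.
    have := irreducible_common_root irr r4 q0;
      rewrite szq cubic_size => /(_ isT).
    rewrite /root rmorphD /= map_polyX map_polyC hornerD hornerX hornerC /=.
    by rewrite -in_algE (rmorph_nat (in_alg L) 4) addNr eqxx.
  move: nz; rewrite /= !inE !mulf_eq0 !subr_eq0 !negb_or andbT.
  by rewrite (eq_sym y3 y) => /andP [/andP [-> ->] ->].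
have gal1 : galois 1%AS <<1; y>>%AS.
  apply/splitting_galoisField; exists (map_poly (in_alg L) (cubic t)); split.
  - by apply/polyOver1P; exists (cubic t).
  - by rewrite pE separable_prod_XsubC.
  exists [:: y; y2; y3]; first by rewrite pE eqpxx.
  apply/eqP; rewrite eqEsubv; apply/andP; split.
    apply/Fadjoin_seqP; split; first exact: sub1v.
    move=> z; rewrite !inE => /or3P [] /eqP -> //; exact: memv_adjoin.
  apply/FadjoinP; split; first exact: sub1v.
  by apply: seqv_sub_adjoin; rewrite mem_head.
split=> //; apply: prime_cyclic; rewrite -galois_dim // dimv1 divn1.
rewrite dim_Fadjoin dimv1 muln1.
by have /eqP := adjoin_degree_irreducible irr rooty;
  rewrite cubic_size eqSS => /eqP ->.
Qed.

Section Degrees.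

Variables (L : fieldExtType rat).

Lemma adjoin_degree_leq (K : {subfield L}) (p : {poly L}) (x : L) :
  p \is a polyOver K -> p != 0 -> root p x -> (adjoin_degree K x < size p)%N.
Proof.
by move=> Kp p0 px; rewrite -size_minPoly dvdp_leq // minPoly_dvdp.
Qed.

Lemma sextic_dim (t c : int) (s y : L)
    (K : {subfield L} := <<1 & [:: s; y]>>%AS) :
    irreducible_poly (cubic t) -> root (map_poly (in_alg L) (cubic t)) y ->
    s ^+ 2 = c%:~R ->
  coprime 7 (\dim K).
Proof.
move=> irr rooty s2.
have -> : \dim K = (adjoin_degree <<1; s>>%AS y * adjoin_degree 1%AS s)%N.
  rewrite /K /= adjoin_cons adjoin_seq1 (dim_Fadjoin <<1; s>>%AS y).
  by rewrite (dim_Fadjoin 1%AS s) dimv1 muln1.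
have ys : (adjoin_degree <<1; s>>%AS y < 4)%N.
  have sz4 : size (map_poly (in_alg L) (cubic t)) = 4.
    by rewrite size_map_poly cubic_size.
  have := @adjoin_degree_leq <<1; s>>%AS _ _ (alg_polyOver _ (cubic t)) _ rooty.
  by rewrite sz4; apply; rewrite -size_poly_gt0 sz4.
have sz : size ('X^2 - c%:~R%:P : {poly L}) = 3.
  by rewrite size_polyDl size_polyXn // size_polyN
    (leq_ltn_trans (size_polyC_leq1 _)).
have s1 : (adjoin_degree 1%AS s < 3)%N.
  have := @adjoin_degree_leq 1%AS ('X^2 - c%:~R%:P) s; rewrite sz; apply.
  - by rewrite rpredB ?rpredX ?polyOverX // polyOverC -mulrzl rpredM ?rpredMz
    ?rpred1.
  - by rewrite -size_poly_gt0 sz.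
  - by rewrite /root hornerD hornerN hornerXn hornerC s2 subrr.
rewrite prime_coprime //; apply/negP; rewrite Euclid_dvdM // => /orP []
  /dvdn_leq.
  by move=> /(_ isT); rewrite leqNgt (leq_trans ys).
by move=> /(_ isT); rewrite leqNgt (leq_trans s1).
Qed.

End Degrees.

Lemma resolvent_coef_morph (F F' : fieldType) (f : {rmorphism F -> F'})
    (Y1 Y2 Y4 e : F) k :
  f (resolvent_coef Y1 Y2 Y4 e k) =
  resolvent_coef (f Y1) (f Y2) (f Y4) (f e) k.
Proof.
by move: k; apply: forall_Z7; rewrite /resolvent_coef; eval_ord; rewrite /=;
  ring.
Qed.

Lemma resolvent_coef_in (L : fieldExtType rat) (K : {subfield L})
    (Y1 Y2 Y4 e : L) k :
  Y1 \in K -> Y2 \in K -> Y4 \in K -> e \in K ->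
  resolvent_coef Y1 Y2 Y4 e k \in K.
Proof.
move=> K1 K2 K4 Ke; move: k.
apply: forall_Z7; rewrite /resolvent_coef; eval_ord; rewrite /=;
by rewrite ?(rpredN, rpredD, rpredB, rpredM, rpredX, rpred_nat, rpred1, K1, K2,
  K4, Ke).
Qed.

(** * Action of the Galois group on the roots of the septic *)

Section SepticGalois.

Variables (L : splittingFieldType rat) (t : int) (y s : L) (E : {subfield L}).
Hypothesis irr3 : irreducible_poly (cubic t).
Hypothesis irr7 : irreducible_poly (septic t).
Hypothesis rooty : root (map_poly (in_alg L) (cubic t)) y.
Hypothesis s2 : s ^+ 2 = (- 7 * (t ^+ 2 - 3 * t + 9))%:~R.
Let K : {subfield L} := <<1 & [:: s; y]>>%AS.
Hypothesis splitE : splittingFieldFor K (map_poly (in_alg L) (septic t)) E.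

Let T : L := t%:~R.
Let u := T ^+ 2 - 3 * T + 9.
Let F z := z ^+ 7 + 7 * z ^+ 6 - 112 * u * z ^+ 2 + 448 * u * z
  + 64 * u * (T - 8).

Let Ks : s \in K.
Proof. by apply: seqv_sub_adjoin; rewrite mem_head. Qed.

Let Ky : y \in K.
Proof. by apply: seqv_sub_adjoin; rewrite !inE eqxx orbT. Qed.

Let KE : (K <= E)%VS.
Proof. by case: splitE => rs _ <-; apply: subv_adjoin_seq. Qed.

Let n7 (F' : fieldType) (f : {rmorphism L -> F'}) (n : nat) :
  n.+1%:R != 0 :> F'.
Proof.
by rewrite -(rmorph_nat f) fmorph_eq0 -(rmorph_nat (in_alg L)) fmorph_eq0
  pnatr_eq0.
Qed.

Lemma resolvent_roots : exists (F' : fieldType) (f : {rmorphism L -> F'})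
    (zeta : F') (z : 'Z_7 -> L) (c : 'Z_7 -> L),
  [/\ 7.-primitive_root zeta, forall i, z i \in E /\ F (z i) = 0,
    (forall k, dft zeta (f \o z) k != 0) /\ \sum_i z i = - 7,
    corr2 z =1 fun k => if k == 0 then 49 else 0 &
    corr3 z =1 c /\ forall k, c k \in K].
Proof.
have [[y2 y3] /= [yy2 yy3] [e1 e2 e3 disc]] := cubic_conjugates irr3 rooty.
have [|F1 [f1 [zeta1 zeta1P]]] := @exists_primitive_root7 L.
  exact: (n7 idfun 6).
pose al := kummer_radicand zeta1 (f1 y) (f1 y2) (f1 y3) (f1 s).
have [|F2 [f2 [a]]] := @exists_root_extension F1 ('X^7 - al%:P).
  by rewrite size_XnsubC.
rewrite rmorphB /= map_polyXn map_polyC /root !hornerE subr_eq0 => /eqP aE.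
pose f : {rmorphism L -> F2} := f2 \o f1.
pose zeta := f2 zeta1.
have zetaP : 7.-primitive_root zeta by rewrite fmorph_primitive_root.
have u0 : f u != 0 by rewrite fmorph_eq0 (quad_neq0 (in_alg L)).
have uE : f T ^+ 2 - 3 * f T + 9 = f u.
  by rewrite /u; ring.
have aE' : a ^+ 7 = kummer_radicand zeta (f y) (f y2) (f y3) (f s).
  rewrite aE.
  exact: (kummer_radicand_morph f2 zeta1 (f1 y) (f1 y2) (f1 y3) (f1 s)).
have [] := @septic_resolvents F2 zeta (f y) (f y2) (f y3) (f s) (f T)
  (n7 f 1) (n7 f 2) (n7 f 6) _ zetaP _ _ _ _ _ a aE'.
- by rewrite uE.
- by transitivity (f (y + y2 + y3)); [ring | rewrite e1].
- transitivity (f (y * y2 + y2 * y3 + y3 * y)); first by ring.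
  by rewrite e2; ring.
- transitivity (f (y * y2 * y3)); first by ring.
  by rewrite e3; ring.
- transitivity (f ((y - y2) * (y2 - y3) * (y3 - y))); first by ring.
  by rewrite disc uE -/u; ring.
- by rewrite uE -rmorphXn s2 /u /T; ring.
rewrite uE => zF [rootz nz z0 c2 c3].
have [rs pE EE] := splitE.
have fTE : f T = t%:~R := rmorph_int f t.
(* Over [E] the septic is a product of linear factors, so its roots in the auxiliary field are
   images of elements of [E]. *)
have zL i : exists z, z \in E /\ f z = zF i.
  have : root (map_poly f (map_poly (in_alg L) (septic t))) (zF i + 1).
    rewrite /root -map_poly_comp (septic_horner (f \o in_alg L)).
    by rewrite -fTE uE; apply/eqP/rootz.
  have -> : root (map_poly f (map_poly (in_alg L) (septic t))) =1
      root (map_poly f (\prod_(z <- rs) ('X - z%:P))).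
    by apply: eqp_root; rewrite eqp_map.
  rewrite rmorph_prod /= (eq_bigr (fun z => 'X - (f z)%:P)); last first.
    by move=> z _; rewrite rmorphB /= map_polyX map_polyC.
  rewrite -(big_map f predT (fun z => 'X - z%:P)) root_prod_XsubC.
  case/mapP => x rsx xE; exists (x - 1); split.
    by rewrite rpredB ?rpred1 // -EE; apply: seqv_sub_adjoin.
  have fx : f x = zF i + 1 := esym xE.
  by transitivity (f x - 1); [ring | rewrite fx; ring].
have /fin_all_exists [z zE] := zL.
have fz i : f (z i) = zF i by case: (zE i).
pose c k : L := 49 * resolvent_coef (y - y2) (y2 - y3) (y3 - y)
  (2 * s / (49 * u)) k.
exists F2, f, zeta, z, c; split=> //.
- move=> i; have [Ezi _] := zE i; split=> //; apply: (fmorph_inj f).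
  rewrite rmorph0 -[RHS](rootz i) -uE -fz /F /u.
  ring.
- split=> [k|].
    rewrite (_ : dft _ _ _ = dft zeta zF k) //.
    by apply: eq_bigr => i _; congr (_ * _); apply: fz.
  apply: (fmorph_inj f); rewrite rmorph_sum rmorphN (rmorph_nat f 7) -z0.
  by apply: eq_bigr => i _; rewrite mulr0 oppr0 chi0 mulr1; apply: fz.
- move=> k; apply: (fmorph_inj f).
  have -> : f (if k == 0 then 49 else 0) = if k == 0 then 49 else 0.
    by case: eqP => _; rewrite ?rmorph0 // (rmorph_nat f 49).
  rewrite -c2 rmorph_sum; apply: eq_bigr => i _.
  by rewrite rmorphM; congr (_ * _); apply: fz.
split=> k.
  apply: (fmorph_inj f); rewrite /c rmorphM (rmorph_nat f 49).
  have -> :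
      f (resolvent_coef (y - y2) (y2 - y3) (y3 - y) (2 * s / (49 * u)) k) =
      resolvent_coef (f y - f y2) (f y2 - f y3) (f y3 - f y)
        (2 * f s / (49 * f u)) k.
    by rewrite resolvent_coef_morph; congr resolvent_coef; try ring; field;
      rewrite ?(n7 f 48) ?u0 ?fmorph_eq0 ?(quad_neq0 (in_alg L)).
  rewrite -c3 rmorph_sum; apply: eq_bigr => i _.
  rewrite rmorph_sum; apply: eq_bigr => j _.
  by rewrite !rmorphM; congr (_ * _ * _); apply: fz.
have sub1 x : x \in <<1; y>>%VS -> x \in K.
  apply/subvP/FadjoinP; split; first exact: sub1v.
  exact: Ky.
have TK (n : int) : n%:~R \in K by rewrite -mulrzl rpredM ?rpredMz ?rpred1.
rewrite /c rpredM ?rpred_nat ?rpred1 //; apply: resolvent_coef_in.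
- by rewrite rpredB ?Ky ?sub1.
- by rewrite rpredB ?Ky ?sub1.
- by rewrite rpredB ?Ky ?sub1.
apply: rpred_div; rewrite /u /T;
by rewrite ?(rpredN, rpredD, rpredB, rpredM, rpredX, rpred_nat, rpred1, Ks, TK).
Qed.

(** 7 divides [[K(x) : Q] = [K(x) : K] [K : Q]] and is prime to the second factor, so the septic
    stays irreducible over [K]. *)
Lemma septic_degree x : root (map_poly (in_alg L) (septic t)) x ->
  adjoin_degree K x = 7 /\ minPoly K x %= map_poly (in_alg L) (septic t).
Proof.
move=> px; have sz8 : size (map_poly (in_alg L) (septic t)) = 8.
  by rewrite size_map_poly septic_size.
have mp : minPoly K x %| map_poly (in_alg L) (septic t).
  by apply: minPoly_dvdp => //; apply: alg_polyOver.
have p0 : map_poly (in_alg L) (septic t) != 0.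
  by rewrite -size_poly_eq0 sz8.
have d7 : adjoin_degree K x = 7.
  apply/eqP; rewrite eqn_leq; apply/andP; split.
    by have := dvdp_leq p0 mp; rewrite sz8 size_minPoly ltnS.
  rewrite dvdn_leq // -(Gauss_dvdl _ (sextic_dim irr3 rooty s2)) -/K.
  rewrite -(dim_Fadjoin K x).
  have /eqP := adjoin_degree_irreducible irr7 px;
    rewrite septic_size eqSS => /eqP d1.
  have -> : 7%N = \dim <<1; x>> by rewrite (dim_Fadjoin 1%AS x) dimv1 muln1 d1.
  apply: field_dimS; apply/FadjoinP; split; first exact: sub1v.
  exact: memv_adjoin.
split=> //; rewrite -dvdp_size_eqp // sz8 size_minPoly.
by apply/eqP; congr S.
Qed.

Lemma septic_galois : [/\ galois K E, #|'Gal(E / K)%g| = 7 &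
  exists z : 'Z_7 -> L, [/\ injective z, forall i, z i \in E,
    forall i, F (z i) = 0,
    forall i, exists2 g, g \in 'Gal(E / K)%g & z i = g (z 0) &
    \sum_i z i = - 7 /\ \sum_i z i ^+ 2 = 49]].
Proof.
have [F' [f [zeta [z [c [zetaP zF [nz z1] c2 [c3 cK]]]]]]] := resolvent_roots.
have Ez i : z i \in E by case: (zF i).
have rootz i : root (map_poly (in_alg L) (septic t)) (z i + 1).
  by rewrite /root septic_horner; apply/eqP; case: (zF i).
have galKE : galois K E.
  apply/splitting_galoisField; exists (map_poly (in_alg L) (septic t)).
  split=> //; first exact: alg_polyOver.
  have [_ pE] := septic_degree (rootz 0).
  rewrite -(eqp_separable pE); apply: pcharf0_separable => p.
  rewrite !inE; apply/negP => /andP [/prime_gt0 p0].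
  by rewrite -(rmorph_nat (in_alg L)) fmorph_eq0 pnatr_eq0 -[_ == _]negbK -lt0n
    p0.
(* Both families are compared in the auxiliary field with the same [zeta]: [g] acts before [f], and
   its only effect to control is on correlations, which it fixes. *)
have gz g : g \in 'Gal(E / K)%g -> exists j, forall i, g (z i) = z (i + j).
  move=> Gg; pose gz i := g (z i).
  have fixK a : a \in K -> g a = a by apply: fixed_gal Gg.
  have fg2 k : corr2 (f \o gz) k = f (g (corr2 z k)).
    rewrite /corr2 !rmorph_sum; apply: eq_bigr => i _.
    by rewrite /= !rmorphM.
  have fg3 k : corr3 (f \o gz) k = f (g (corr3 z k)).
    rewrite /corr3 !rmorph_sum; apply: eq_bigr => i _.
    by rewrite !rmorph_sum; apply: eq_bigr => l _; rewrite /= !rmorphM.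
  have f2 k : corr2 (f \o z) k = f (corr2 z k).
    by rewrite /corr2 rmorph_sum; apply: eq_bigr => i _; rewrite rmorphM.
  have f3 k : corr3 (f \o z) k = f (corr3 z k).
    rewrite /corr3 rmorph_sum; apply: eq_bigr => i _; rewrite rmorph_sum.
    by apply: eq_bigr => l _; rewrite !rmorphM.
  have E0 h : dft zeta h 0 = \sum_i h i.
    by apply: eq_bigr => i _; rewrite mulr0 oppr0 chi0 mulr1.
  have [j jE] : exists j, forall i, (f \o gz) i = (f \o z) (i + j).
    apply: (corr_shift (n7 f 6) zetaP nz) => [|k|k].
    - rewrite !E0 /= -!rmorph_sum z1 rmorphN.
      by congr (f (- _)); apply: (rmorph_nat g 7).
    - rewrite fg2 f2 c2; congr (f _); case: (k == 0); last exact: rmorph0.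
      exact: (rmorph_nat g 49).
    - by rewrite fg3 f3 c3 fixK.
  by exists j => i; apply: (fmorph_inj f); apply: jE.
(* The seven distinct conjugates of [z 0] are all of the form [z j]; by counting, [z] is injective
   and the action transitive. *)
have /(_ _ (Ez 0)) [r /= [rG uniqr rE]] := elimT (galois_factors KE) galKE.
have szr : size r = 7.
  have [d7 _] := septic_degree (rootz 0).
  have Kz : <<K; z 0%R + 1>>%VS = <<K; z 0%R>>%VS.
    apply/eqP; rewrite eqEsubv; apply/andP.
    split; apply/FadjoinP; rewrite subv_adjoin; split=> //.
      by rewrite rpredD ?rpred1 ?memv_adjoin.
    by rewrite -{1}[z 0](addrK 1) rpredB ?rpred1 ?memv_adjoin.
  have : size (minPoly K (z 0)) = 8.
    by rewrite size_minPoly adjoin_degreeE -Kz -adjoin_degreeE d7.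
  by rewrite rE big_map size_prod_XsubC => -[].
have sub_r : {subset [seq g (z 0) | g : gal_of E <- r] <= codom z}.
  move=> _ /mapP [g gr ->]; have [j ->] := gz g (subsetP rG g gr).
  exact: codom_f.
have szz : size (codom z) = 7 by rewrite size_codom card_ord.
have szrz : size [seq g (z 0) | g : gal_of E <- r] = 7 by rewrite size_map.
have leqz : (size (codom z) <= size [seq g (z 0%R) | g : gal_of E <- r])%N.
  by rewrite szrz szz.
have [eqz uniqz] := uniq_min_size uniqr sub_r leqz.
have injz : injective z.
  by apply/injectiveP; rewrite /injectiveb /dinjectiveb -(eq_uniq eqz uniqz).
have mem_root_septic a : root (map_poly (in_alg L) (septic t)) a ->
    exists i, a = z i + 1.
  move=> ra; apply: NNPP => na.
  have := @max_poly_roots _ (map_poly (in_alg L) (septic t))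
    (a :: [seq z i + 1 | i <- enum 'Z_7]).
  rewrite -size_poly_eq0 size_map_poly septic_size /= size_map -cardE card_ord.
  rewrite ltnn ra map_inj_uniq ?enum_uniq; last by move=> i j /addIr /injz.
  rewrite (_ : all _ _ = true); last by apply/allP => _ /mapP [i _ ->].
  move=> /(_ isT isT) notuniq.
  have /mapP [i _ aE] : a \in [seq z i + 1 | i <- enum 'Z_7].
    by apply: contraT => nin; move: notuniq; rewrite nin => /(_ isT).
  by apply: na; exists i.
have transz i : exists2 g, g \in 'Gal(E / K)%g & z i = g (z 0).
  have : z i \in codom z by apply: codom_f.
  by rewrite -uniqz => /mapP [g gr ->]; exists g => //; apply: (subsetP rG).
(* The image of [z 0] determines the shift, hence the action on all roots, and these generate [E]
   over [K]. *)
have galz0 : {in 'Gal(E / K)%g &, injective (fun g : gal_of E => g (z 0))}.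
  move=> g h Gg Gh /= gh; have [j gE] := gz g Gg; have [k hE] := gz h Gh.
  have jk : j = k by apply: injz; move: gh; rewrite gE hE !add0r.
  have gzE i : g (z i) = h (z i) by rewrite gE hE jk.
  have ghE a : a \in E -> g a = h a -> (g * h^-1)%g a = a.
    by move=> Ea gh'; rewrite galM // gh' -galM // mulgV gal_id.
  have EM : (E <= fixedField [set (g * h^-1)%g])%VS.
    have [rs pE EE] := splitE; rewrite -{1}EE; apply/Fadjoin_seqP; split.
      apply/subvP => a Ka; apply/fixedFieldP; first exact: (subvP KE).
      move=> _ /set1P ->; apply: ghE; first exact: (subvP KE).
      by rewrite (fixed_gal KE Gg) // (fixed_gal KE Gh).
    move=> a rsa; have [i ->] : exists i, a = z i + 1.
      by apply: mem_root_septic; rewrite (eqp_root pE) root_prod_XsubC.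
    apply/fixedFieldP; first by rewrite rpredD ?rpred1.
    move=> _ /set1P ->; apply: ghE; first by rewrite rpredD ?rpred1.
    rewrite rmorphD [RHS]rmorphD; congr (_ + _); first exact: gzE.
    by rewrite !rmorph1.
  apply/eqP/gal_eqP => a Ea.
  have /fixedFieldP := subvP EM a Ea; move=> /(_ Ea) /(_ _ (set11 _)) gha.
  by rewrite -[in RHS]gha -galM ?memv_gal // mulgKV.
split=> //.
  apply/eqP; rewrite eqn_leq; apply/andP; split.
    rewrite cardE -szz -(size_map (fun g : gal_of E => g (z 0))).
    apply: uniq_leq_size.
      rewrite map_inj_in_uniq ?enum_uniq // => g h.
      by rewrite !mem_enum; apply: galz0.
    move=> x /mapP [g]; rewrite mem_enum => Gg ->; have [j ->] := gz g Gg.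
    exact: codom_f.
  rewrite -szr -(card_uniqP (map_uniq uniqr)); apply: subset_leq_card.
  exact: rG.
exists z; split=> //; first by move=> i; case: (zF i).
split=> //; rewrite -[RHS](c2 0); apply: eq_bigr => i _.
by rewrite add0r.
Qed.

End SepticGalois.

(** * The septic at 7 *)

Section NewtonPolygon.

Variables (L : fieldExtType rat) (w : L) (N j : nat) (d : nat -> int).
Hypothesis N0 : (0 < N)%N.
(** The ceiling of [j (7 - i) / 6], against the floor in [e] below. Slopes are counted in sixths
    because the tame ramification at 7 has index dividing 6. *)
Let f i := ((j * (7 - i) + 5) %/ 6)%N.
Let c i : int := N%:Z ^+ f i * d i.
Hypothesis wE : w ^+ 7 + \sum_(i < 7) (c i)%:~R * w ^+ i = 0.

Let e k := ((j * k) %/ 6)%N.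
Let m k : L := w ^+ k / N%:R ^+ e k.
Let M (x : L) := exists b : 'I_7 -> int, x = \sum_(i < 7) (b i)%:~R * m i.

Let NL0 k : N%:R ^+ k != 0 :> L.
Proof.
by rewrite expf_neq0 // -(rmorph_nat (in_alg L)) fmorph_eq0 pnatr_eq0 -lt0n.
Qed.

Let MD x y : M x -> M y -> M (x + y).
Proof.
move=> [b ->] [b' ->]; exists (fun i => b i + b' i).
by rewrite -big_split; apply: eq_bigr => i _ /=; rewrite rmorphD mulrDl.
Qed.

Let MZ (n : int) x : M x -> M (n%:~R * x).
Proof.
move=> [b ->]; exists (fun i => n * b i).
by rewrite big_distrr; apply: eq_bigr => i _ /=; rewrite rmorphM mulrA.
Qed.

Let M0 : M 0.
Proof. by exists (fun=> 0); rewrite big1 // => i _; rewrite mul0r. Qed.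

Let Mm k : M (m k).
Proof.
elim/ltn_ind: k => k IH; have [k7|k7] := ltnP k 7.
  exists (fun i => (i == Ordinal k7)%:Z).
  rewrite (bigD1 (Ordinal k7)) //= eqxx mul1r big1 ?addr0 // => i /negPf ->.
  by rewrite mul0r.
have [b kE] : exists b, k = (b + 7)%N by exists (k - 7)%N; rewrite subnK.
have -> : m k = \sum_(i < 7)
    (- N%:Z ^+ (f i - (e k - e (b + i))) * d i)%:~R * m (b + i)%N.
  have w7 : w ^+ 7 = \sum_(i < 7) - (c i)%:~R * w ^+ i.
    move/eqP: wE; rewrite addr_eq0 => /eqP ->; rewrite -sumrN.
    by apply: eq_bigr => i _; rewrite mulNr.
  rewrite /m kE exprD w7 big_distrr big_distrl; apply: eq_bigr => i _ /=.
  rewrite -kE exprD; set x := w ^+ b * w ^+ i.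
  have ek : (e (b + i) <= e k)%N.
    by rewrite leq_div2r // leq_mul2l kE leq_add2l ltnW ?orbT.
  (* The floor of a sum is at most the floor of one term plus the ceiling of the other. *)
  have fe : (e k - e (b + i) <= f i)%N.
    rewrite /e /f kE; have := ltn_ord i; move: (nat_of_ord i) => i' i7.
    nia.
  rewrite /c !(rmorphM, rmorphN, rmorphXn) /= -!(pmulrn 1).
  have -> : (N%:R : L) ^+ f i =
      N%:R ^+ (f i - (e k - e (b + i))) * N%:R ^+ (e k - e (b + i)).
    by rewrite -exprD subnK.
  have -> : (N%:R : L) ^+ e k = N%:R ^+ (e k - e (b + i)) * N%:R ^+ e (b + i).
    by rewrite -exprD subnK.
  by rewrite /x; field; rewrite !NL0.
elim/big_rec: _ => [|i x _ Mx]; first exact: M0.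
by apply: MD Mx; apply/MZ/IH; rewrite kE ltn_add2l.
Qed.

Let MM k b : M (m k * m b).
Proof.
have eD : (e k + e b <= e (k + b))%N.
  by rewrite /e mulnDr; nia.
have -> : m k * m b = (N%:Z ^+ (e (k + b) - (e k + e b)))%:~R * m (k + b)%N.
  rewrite /m rmorphXn /= -!(pmulrn 1).
  have -> : (N%:R : L) ^+ e (k + b) =
      N%:R ^+ (e (k + b) - (e k + e b)) * (N%:R ^+ e k * N%:R ^+ e b).
    by rewrite -!exprD subnK.
  by rewrite exprD; field; rewrite !NL0.
exact: MZ.
Qed.

(** The integral span of [m 0, ..., m 6] is stable under multiplication by [m k], so [m k] is an
    eigenvalue of an integer matrix; the eigenvector is nonzero because [m 0 = 1]. *)
Lemma newton_polygon_integral k : integralOver (intmul 1 : int -> L) (m k).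
Proof.
have /fin_all_exists [A AE] : forall b : 'I_7, exists a : {ffun 'I_7 -> int},
    m k * m b = \sum_(i < 7) (a i)%:~R * m i.
  move=> b; have [a aE] := MM k b; exists [ffun i => a i].
  by rewrite aE; apply: eq_bigr => i _; rewrite ffunE.
pose B : 'M[int]_7 := \matrix_(i, b) A b i.
exists (char_poly B); first exact: char_poly_monic.
rewrite map_char_poly -eigenvalue_root_char; apply/eigenvalueP.
exists (\row_i m i); last first.
  apply/eqP => /rowP /(_ 0); rewrite !mxE /m /e muln0 div0n !expr0 divr1.
  by move/eqP; rewrite oner_eq0.
apply/rowP => b; rewrite !mxE AE; apply: eq_bigr => i _.
by rewrite !mxE mulrC.
Qed.

End NewtonPolygon.

(** * Newton's identities in degree 7 *)

Lemma deriv_prod (R : comRingType) (I : eqType) (r : seq I)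
    (F : I -> {poly R}) :
  uniq r -> (\prod_(i <- r) F i)^`() =
    \sum_(i <- r) (F i)^`() * \prod_(j <- r | j != i) F j.
Proof.
elim: r => [|a r IH]; first by rewrite !big_nil derivC.
rewrite cons_uniq => /andP [ar /IH {}IH].
rewrite !big_cons derivM IH eqxx /=; congr (_ * _ + _).
  rewrite big_seq [RHS]big_seq_cond; apply: eq_bigl => j.
  by case: (boolP (j \in r)) => // jr; rewrite (memPn ar).
rewrite big_distrr big_seq [RHS]big_seq; apply: eq_bigr => i ir /=.
by rewrite big_cons eq_sym (memPn ar) // mulrCA.
Qed.

(* Newton's identities: [power_sum7 c k] is the k-th power sum of the roots of
   the monic polynomial of degree 7 with coefficients [c], for k < 7. *)
Definition power_sum7 (R : pzRingType) (c : nat -> R) (k : nat) : R :=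
  let p1 := - c 6%N in
  let p2 := - (2 * c 5%N + c 6%N * p1) in
  let p3 := - (3 * c 4%N + c 5%N * p1 + c 6%N * p2) in
  let p4 := - (4 * c 3%N + c 4%N * p1 + c 5%N * p2 + c 6%N * p3) in
  let p5 := - (5 * c 2%N + c 3%N * p1 + c 4%N * p2 + c 5%N * p3 + c 6%N * p4) in
  let p6 := - (6 * c 1%N + c 2%N * p1 + c 3%N * p2 + c 4%N * p3 + c 5%N * p4
    + c 6%N * p5) in
  nth 0 [:: 7; p1; p2; p3; p4; p5; p6] k.

Section Newton7.

Variables (R : idomainType) (I : finType) (w : I -> R) (P : {poly R}).
Hypothesis I7 : #|I| = 7.
Hypothesis PE : P = \prod_i ('X - (w i)%:P).

Let Q i := \prod_(j | j != i) ('X - (w j)%:P).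

Lemma deriv_prod_XsubC : P^`() = \sum_i Q i.
Proof.
rewrite PE -big_enum deriv_prod ?enum_uniq // big_enum /=.
by apply: eq_bigr => i _; rewrite derivXsubC mul1r big_enum_cond.
Qed.

Lemma horner_deriv_prod i : P^`().[w i] = \prod_(j | j != i) (w i - w j).
Proof.
rewrite deriv_prod_XsubC horner_sum (bigD1 i) //= big1 ?addr0.
  by rewrite horner_prod; apply: eq_bigr => j _; rewrite hornerXsubC.
move=> j ji; rewrite horner_prod (bigD1 i) /= ?hornerXsubC ?subrr ?mul0r //.
by rewrite eq_sym.
Qed.

Let c k := P`_k.
Let s k := \sum_i w i ^+ k.

Let PQ i : P = ('X - (w i)%:P) * Q i.
Proof. by rewrite PE (bigD1 i). Qed.

Let szP : size P = 8.
Proof. by rewrite PE -big_enum size_prod_XsubC -cardE I7. Qed.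

Let szQ i : size (Q i) = 7.
Proof.
have Q0 : Q i != 0.
  by apply/prodf_neq0 => j _; rewrite polyXsubC_eq0.
by have /eqP := szP; rewrite (PQ i) size_monicM ?monicXsubC // size_XsubC
  eqSS => /eqP.
Qed.

Let cQ i k : (Q i)`_k = c k.+1 + w i * (Q i)`_k.+1.
Proof.
rewrite /c {1}(PQ i) mulrBl coefB coefXM coefCM /=.
by rewrite subrK.
Qed.

Let c7 : c 7%N = 1.
Proof.
have /monicP : P \is monic by rewrite PE monic_prod_XsubC.
by rewrite /lead_coef szP.
Qed.

Let sum1 x : \sum_(i : I) x = 7 * x :> R.
Proof. by rewrite sumr_const I7 mulr_natl. Qed.

(** Synthetic division ([cQ]) expresses the coefficients of [P / (X - w_i)] as polynomials in [w_i].
    Their sums over [i] are the coefficients of the derivative, and comparing them gives each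
    identity. *)
Lemma newton7 k : (k < 7)%N -> s k = power_sum7 c k.
Proof.
have Q6 i : (Q i)`_6 = 1 by rewrite cQ c7 [(Q i)`_7]nth_default ?szQ // mulr0
  addr0.
have Q5 i : (Q i)`_5 = c 6%N + w i by rewrite cQ Q6 mulr1.
have Q4 i : (Q i)`_4 = c 5%N + c 6%N * w i + w i ^+ 2 by rewrite cQ Q5; ring.
have Q3 i : (Q i)`_3 = c 4%N + c 5%N * w i + c 6%N * w i ^+ 2 + w i ^+ 3.
  by rewrite cQ Q4; ring.
have Q2 i : (Q i)`_2 = c 3%N + c 4%N * w i + c 5%N * w i ^+ 2 + c 6%N * w i ^+ 3
    + w i ^+ 4 by rewrite cQ Q3; ring.
have Q1 i : (Q i)`_1 = c 2%N + c 3%N * w i + c 4%N * w i ^+ 2 + c 5%N * w i ^+ 3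
    + c 6%N * w i ^+ 4 + w i ^+ 5 by rewrite cQ Q2; ring.
have Q0 i : (Q i)`_0 = c 1%N + c 2%N * w i + c 3%N * w i ^+ 2 + c 4%N * w i ^+ 3
    + c 5%N * w i ^+ 4 + c 6%N * w i ^+ 5 + w i ^+ 6 by rewrite cQ Q1; ring.
have dP l : c l.+1 *+ l.+1 = \sum_i (Q i)`_l.
  by rewrite /c -coef_deriv deriv_prod_XsubC coef_sum.
have w1 : \sum_i w i = s 1 by apply: eq_bigr => i _; rewrite expr1.
have s1 : s 1 = - c 6%N.
  have := dP 5; under eq_bigr do rewrite Q5.
  rewrite big_split /= sum1 w1 => H.
  by rewrite -[LHS](addKr (7 * c 6%N)) -H; ring.
have s2 : s 2 = - (2 * c 5%N + c 6%N * s 1).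
  have := dP 4; under eq_bigr do rewrite Q4.
  rewrite !big_split /= sum1 -!big_distrr /= w1 => H.
  by rewrite -[LHS](addKr (7 * c 5%N + c 6%N * s 1)) -H; ring.
have s3 : s 3 = - (3 * c 4%N + c 5%N * s 1 + c 6%N * s 2).
  have := dP 3; under eq_bigr do rewrite Q3.
  rewrite !big_split /= sum1 -!big_distrr /= w1 => H.
  by rewrite -[LHS](addKr (7 * c 4%N + c 5%N * s 1 + c 6%N * s 2)) -H; ring.
have s4 : s 4 = - (4 * c 3%N + c 4%N * s 1 + c 5%N * s 2 + c 6%N * s 3).
  have := dP 2; under eq_bigr do rewrite Q2.
  rewrite !big_split /= sum1 -!big_distrr /= w1 => H.
  by rewrite -[LHS](addKr (7 * c 3%N + c 4%N * s 1 + c 5%N * s 2 + c 6%N * s 3))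
    -H; ring.
have s5 : s 5 = - (5 * c 2%N + c 3%N * s 1 + c 4%N * s 2 + c 5%N * s 3
  + c 6%N * s 4).
  have := dP 1; under eq_bigr do rewrite Q1.
  rewrite !big_split /= sum1 -!big_distrr /= w1 => H.
  by rewrite -[LHS](addKr (7 * c 2%N + c 3%N * s 1 + c 4%N * s 2 + c 5%N * s 3
    + c 6%N * s 4)) -H; ring.
have s6 : s 6 = - (6 * c 1%N + c 2%N * s 1 + c 3%N * s 2 + c 4%N * s 3
  + c 5%N * s 4 + c 6%N * s 5).
  have := dP 0; under eq_bigr do rewrite Q0.
  rewrite !big_split /= sum1 -!big_distrr /= w1 => H.
  by rewrite -[LHS](addKr (7 * c 1%N + c 2%N * s 1 + c 3%N * s 2 + c 4%N * s 3
    + c 5%N * s 4 + c 6%N * s 5)) -H; ring.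
have s0 : s 0 = 7.
  by rewrite /s; under eq_bigr do rewrite expr0; rewrite sumr_const I7.
case: k => [|[|[|[|[|[|[|//]]]]]]] _; rewrite /power_sum7 /=.
- exact: s0.
- exact: s1.
- by rewrite -s1 -s2.
- by rewrite -s1 -s2 -s3.
- by rewrite -s1 -s2 -s3 -s4.
- by rewrite -s1 -s2 -s3 -s4 -s5.
- by rewrite -s1 -s2 -s3 -s4 -s5 -s6.
Qed.

End Newton7.

(** The Taylor coefficients at [a], below the leading one, of the septic in the variable [z]. *)
Definition septic_coef (t a : int) : nat -> int :=
  let u := t ^+ 2 - 3 * t + 9 in
  nth 0 [:: a ^+ 7 + 7 * a ^+ 6 - 112 * u * a ^+ 2 + 448 * u * a
    + 64 * u * (t - 8);
    7 * a ^+ 6 + 42 * a ^+ 5 - 224 * u * a + 448 * u;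
    21 * a ^+ 5 + 105 * a ^+ 4 - 112 * u; 35 * a ^+ 4 + 140 * a ^+ 3;
    35 * a ^+ 3 + 105 * a ^+ 2; 21 * a ^+ 2 + 42 * a; 7 * a + 7].

Lemma septic_shift (R : comRingType) (t a : int) (w : R) (T : R := t%:~R)
    (u := T ^+ 2 - 3 * T + 9) (z := w + a%:~R) :
  z ^+ 7 + 7 * z ^+ 6 - 112 * u * z ^+ 2 + 448 * u * z + 64 * u * (T - 8) =
  w ^+ 7 + \sum_(i < 7) (septic_coef t a i)%:~R * w ^+ i.
Proof.
rewrite !big_ord_recl big_ord0 /septic_coef /= /bump /= /u /z /T; ring.
Qed.

(* In terms of Newton polygons: all slopes of the septic translated by [a] are
   at least [j / 6] at 7, and the trace of [w ^+ k / 7 ^ (j * k / 6)] is prime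
   to 7. *)
Definition seventh_condition (t a : int) : Prop :=
  exists (d : nat -> int) (j k : nat) (n : int),
  [/\ forall i, (i < 7)%N ->
        septic_coef t a i = 7%:Z ^+ ((j * (7 - i) + 5) %/ 6) * d i,
      (k < 7)%N, power_sum7 (septic_coef t a) k = 7%:Z ^+ ((j * k) %/ 6) * n
    & ~~ (7 %| n)%Z].

Ltac eval_div := repeat match goal with |- context [(?x %/ 6)%N] =>
  let n := eval vm_compute in (x %/ 6)%N in change (x %/ 6)%N with n end.

Lemma dvdz7D (q r : int) : (7 %| 7 * q + r)%Z = (7 %| r)%Z.
Proof. by rewrite rpredDl // dvdz_mulr. Qed.

(** In the sixth power sum, every term except [- 6 c_1] is a product of at least two multiples of 7.
    The trace of [w ^ 6 / 7] is thus congruent to [- 6 d_1], that is to [d_1], modulo 7. *)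
Lemma seventh_condition1 (t a : int) (d : nat -> int) :
    (forall i, (i < 7)%N ->
      septic_coef t a i = 7%:Z ^+ ((1 * (7 - i) + 5) %/ 6) * d i) ->
  ~~ (7 %| d 1%N)%Z -> exists a, seventh_condition t a.
Proof.
move=> dE nd; exists a, d, 1%N, 6%N.
pose P1 := - d 6%N.
pose P2 := - 2 * d 5%N - 7 * (d 6%N * P1).
pose P3 := - 3 * d 4%N - 7 * (d 5%N * P1 + d 6%N * P2).
pose P4 := - 4 * d 3%N - 7 * (d 4%N * P1 + d 5%N * P2 + d 6%N * P3).
pose P5 := - 5 * d 2%N - 7 * (d 3%N * P1 + d 4%N * P2 + d 5%N * P3
  + d 6%N * P4).
exists (7 * - (d 1%N + d 2%N * P1 + d 3%N * P2 + d 4%N * P3 + d 5%N * P4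
  + d 6%N * P5) + d 1%N).
split=> //; last by rewrite dvdz7D.
rewrite /power_sum7; eval_div; cbn beta iota zeta delta [nth].
rewrite !dE //; eval_div; rewrite /P5 /P4 /P3 /P2 /P1; ring.
Qed.

(** The third power sum is [- 3 c_4 + 3 c_5 c_6 - c_6 ^ 3], where only the first term can be nonzero
    modulo 49. *)
Lemma seventh_condition2 (t a : int) (d : nat -> int) :
    (forall i, (i < 7)%N ->
      septic_coef t a i = 7%:Z ^+ ((2 * (7 - i) + 5) %/ 6) * d i) ->
  ~~ (7 %| d 4%N)%Z -> exists a, seventh_condition t a.
Proof.
move=> dE nd; exists a, d, 2%N, 3%N.
exists (7 * (3 * d 5%N * d 6%N - d 6%N ^+ 3 * 7) - 3 * d 4%N); split=> //.
  rewrite /power_sum7; eval_div; cbn beta iota zeta delta [nth].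
  by rewrite !dE //; eval_div; ring.
by rewrite dvdz7D -mulNr Gauss_dvdzr.
Qed.

(* The number [7 * d 1] (or [7 * d 4]) is independent of [m] modulo 49; larger
   literals are split into sums and products because they are unary. *)
Lemma septic_at7_0 (m : int) (t := 49 * m + 0) :
  exists a, seventh_condition t a.
Proof.
pose d := nth 0 [:: 64 * 7 ^+ 4 * m ^+ 3 - 256 * 7 ^+ 2 * m ^+ 2 + 768 * m;
  256; - 16 * 7 ^+ 4 * m ^+ 2 + 2352 * m + 192;
  240; 100; 24; 3].
have dE i : (i < 7)%N ->
    septic_coef t 2 i = 7%:Z ^+ ((1 * (7 - i) + 5) %/ 6) * d i.
  rewrite /t; case: i => [|[|[|[|[|[|[|//]]]]]]] _;
    by rewrite /septic_coef; eval_div; cbn beta iota zeta delta [nth d]; ring.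
apply: (seventh_condition1 dE).
have -> : d 1%N = 7 * 36 + 4 by cbn beta iota zeta delta [nth d]; ring.
by rewrite dvdz7D.
Qed.

Lemma septic_at7_5 (m : int) (t := 49 * m + 5) :
  exists a, seventh_condition t a.
Proof.
pose d := nth 0 [:: 64 * 7 ^+ 4 * m ^+ 3 + 592 * 7 ^+ 2 * m ^+ 2 + 2224 * m
  + 56;
  32 * 7 ^+ 4 * m ^+ 2 + 32 * 7 ^+ 3 * m + 615; - 16 * 7 ^+ 4 * m ^+ 2
    - 16 * 7 ^+ 3 * m - 286;
  25; 20; 9; 2].
have dE i : (i < 7)%N ->
    septic_coef t 1 i = 7%:Z ^+ ((1 * (7 - i) + 5) %/ 6) * d i.
  rewrite /t; case: i => [|[|[|[|[|[|[|//]]]]]]] _;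
    by rewrite /septic_coef; eval_div; cbn beta iota zeta delta [nth d]; ring.
apply: (seventh_condition1 dE).
have -> : d 1%N = 7 * (32 * 7 ^+ 3 * m ^+ 2 + 1568 * m + 87) + 6
  by cbn beta iota zeta delta [nth d]; ring.
by rewrite dvdz7D.
Qed.

Lemma septic_at7_17 (m : int) (t := 49 * m + 17) :
  exists a, seventh_condition t a.
Proof.
pose d := nth 0 [:: 64 * 7 ^+ 4 * m ^+ 3 + 2896 * 7 ^+ 2 * m ^+ 2
  + (440 * 100 + 80) * m + 4746;
  - 32 * 7 ^+ 4 * m ^+ 2 - 992 * 7 ^+ 2 * m - (57 * 100 + 17);
    - 16 * 7 ^+ 4 * m ^+ 2 - 496 * 7 ^+ 2 * m - 2008;
  945; 270; 45; 4].
have dE i : (i < 7)%N ->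
    septic_coef t 3 i = 7%:Z ^+ ((1 * (7 - i) + 5) %/ 6) * d i.
  rewrite /t; case: i => [|[|[|[|[|[|[|//]]]]]]] _;
    by rewrite /septic_coef; eval_div; cbn beta iota zeta delta [nth d]; ring.
apply: (seventh_condition1 dE).
have -> : d 1%N = 7 * (- 32 * 7 ^+ 3 * m ^+ 2 - (69 * 100 + 44) * m - 817) + 2
  by cbn beta iota zeta delta [nth d]; ring.
by rewrite dvdz7D.
Qed.

Lemma septic_at7_20 (m : int) (t := 49 * m + 20) :
  exists a, seventh_condition t a.
Proof.
pose d := nth 0 [:: 64 * 7 ^+ 4 * m ^+ 3 + 368 * 7 ^+ 3 * m ^+ 2
  + (300 * 100 + 32) * m + (53 * 100 + 8);
  - 96 * 7 ^+ 4 * m ^+ 2 - 3552 * 7 ^+ 2 * m + 871; - 16 * 7 ^+ 4 * m ^+ 2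
    - 592 * 7 ^+ 2 * m + (131 * 100 + 66);
  (56 * 100 + 25); 1000; 105; 6].
have dE i : (i < 7)%N ->
    septic_coef t 5 i = 7%:Z ^+ ((1 * (7 - i) + 5) %/ 6) * d i.
  rewrite /t; case: i => [|[|[|[|[|[|[|//]]]]]]] _;
    by rewrite /septic_coef; eval_div; cbn beta iota zeta delta [nth d]; ring.
apply: (seventh_condition1 dE).
have -> : d 1%N = 7 * (- 96 * 7 ^+ 3 * m ^+ 2 - (248 * 100 + 64) * m + 124) + 3
  by cbn beta iota zeta delta [nth d]; ring.
by rewrite dvdz7D.
Qed.

Lemma septic_at7_25 (m : int) (t := 49 * m + 25) :
  exists a, seventh_condition t a.
Proof.
pose d := nth 0 [:: 64 * 7 ^+ 3 * m ^+ 3 + (310 * 100 + 24) * m ^+ 2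
  + (146 * 100 + 72) * m + 2342;
  - 32 * 7 ^+ 3 * m ^+ 2 - (105 * 100 + 28) * m - 2243; - 16 * 7 ^+ 3 * m ^+ 2
    - (52 * 100 + 64) * m - 1000;
  135; 270; 45; 4].
have dE i : (i < 7)%N ->
    septic_coef t 3 i = 7%:Z ^+ ((2 * (7 - i) + 5) %/ 6) * d i.
  rewrite /t; case: i => [|[|[|[|[|[|[|//]]]]]]] _;
    by rewrite /septic_coef; eval_div; cbn beta iota zeta delta [nth d]; ring.
apply: (seventh_condition2 dE).
have -> : d 4%N = 7 * 38 + 4 by cbn beta iota zeta delta [nth d]; ring.
by rewrite dvdz7D.
Qed.

(** Here [u = 49 v], and the slopes vary with the valuation of [v]. If it is [j < 3], the slope is
    [(3 + j) / 6] and the sixth power is used; otherwise [z / 7] is already integral, and its trace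
    is -1. *)
Lemma septic_at7_8 (m : int) (t := 49 * m + 8) :
  exists a, seventh_condition t a.
Proof.
pose v := 1 + 13 * m + 49 * m ^+ 2.
have tame j x : v = 7 ^+ j * x -> (j < 3)%N -> ~~ (7 %| x)%Z ->
    exists a, seventh_condition t a.
  move=> vE j3 nx; have uE : t ^+ 2 - 3 * t + 9 = 49 * (7 ^+ j * x).
    by rewrite -vE /t /v; ring.
  exists 0, (nth 0 [:: 64 * x * m; 64 * x; - 16 * x; 0; 0; 0; 1]), (3 + j)%N,
    6%N.
  exists (- 1056 * x + 7 ^+ (3 - j)).
  split=> //.
  - case: j vE uE j3 => [|[|[|//]]] vE uE _; case=> [|[|[|[|[|[|[|//]]]]]]] _;
    by rewrite /septic_coef uE; eval_div; cbn beta iota zeta delta [nth];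
      rewrite /t; ring.
  - rewrite /power_sum7; cbn beta iota zeta delta [nth].
    rewrite /septic_coef uE; cbn beta iota zeta delta [nth].
    by case: j vE uE j3 => [|[|[|//]]] vE uE _; eval_div; rewrite ?subSS subn0;
      ring.
  have -> : - 1056 * x + 7 ^+ (3 - j) = 7 * (- 151 * x + 7 ^+ (2 - j)) + x.
    by case: j vE uE j3 => [|[|[|//]]] _ _ _; rewrite ?subSS ?subn0; ring.
  by rewrite dvdz7D.
have [/dvdzP [v1 v1E]|n0] := boolP (7 %| v)%Z; last by apply: (tame 0 v);
  rewrite ?mul1r.
have [/dvdzP [v2 v2E]|n1] := boolP (7 %| v1)%Z; last first.
  by apply: (tame 1 v1); rewrite // v1E; ring.
have [/dvdzP [v3 v3E]|n2] := boolP (7 %| v2)%Z; last first.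
  by apply: (tame 2 v2); rewrite // v1E v2E; ring.
have uE : t ^+ 2 - 3 * t + 9 = 49 * (v3 * 7 * 7 * 7).
  by rewrite -v3E -v2E -v1E /t /v; ring.
exists 0, (nth 0 [:: 64 * v3 * m; 64 * v3; - 112 * v3; 0; 0; 0; 1]), 6%N, 1%N,
  (- 1).
split=> //.
case=> [|[|[|[|[|[|[|//]]]]]]] _;
  by rewrite /septic_coef uE; eval_div; cbn beta iota zeta delta [nth];
    rewrite /t; ring.
Qed.

(** Modulo 7 the septic is [z ^ 7 + u (t - 8) = (z - a) ^ 7] with [a = - u (t - 8)], which dictates
    the translations 2, 1, 0, 3, 5, 3. The residue of [t] modulo 49 makes the value at [a] divisible
    by 49, as every positive slope requires. *)
Lemma septic_at7 (t : int) :
  (t %% 49)%Z \in [:: 0; 5; 8; 17; 20; 25] -> exists a, seventh_condition t a.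
Proof.
have := divz_eq t 49; rewrite [(_ * 49)%R]mulrC.
move: (t %/ 49)%Z (t %% 49)%Z => m r ->; rewrite !inE.
case/or4P => [/eqP ->|/eqP ->|/eqP ->|].
- exact: septic_at7_0.
- exact: septic_at7_5.
- exact: septic_at7_8.
case/or3P => /eqP ->.
- exact: septic_at7_17.
- exact: septic_at7_20.
- exact: septic_at7_25.
Qed.

(** * Ramification of the septic *)

Lemma power_sum7_morph (R S : pzRingType) (f : {rmorphism R -> S})
    (c : nat -> R) (c' : nat -> S) k :
  (forall i, (0 < i < 7)%N -> c' i = f (c i)) ->
  (k < 7)%N -> power_sum7 c' k = f (power_sum7 c k).
Proof.
move=> cE k7; have fn n : f n%:R = n%:R := rmorph_nat f n.
case: k k7 => [|[|[|[|[|[|[|//]]]]]]] _; rewrite /power_sum7;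
  cbn beta iota zeta delta [nth]; rewrite ?cE //;
  by rewrite ?(fn, rmorphN, rmorphD, rmorphM).
Qed.

Section UnramifiedFinite.

Variables (L : splittingFieldType rat) (t : int) (K E : {subfield L}).
Hypothesis t49 : (t %% 49)%Z \in [:: 0; 5; 8; 17; 20; 25].
Let T : L := t%:~R.
Let u := T ^+ 2 - 3 * T + 9.
Variable z : 'Z_7 -> L.
Hypotheses (zinj : injective z) (Ez : forall i, z i \in E).
Hypothesis zF : forall i, z i ^+ 7 + 7 * z i ^+ 6 - 112 * u * z i ^+ 2
  + 448 * u * z i + 64 * u * (T - 8) = 0.
Hypothesis zgal : forall i, exists2 g, g \in 'Gal(E / K)%g & z i = g (z 0).
Hypotheses (z1 : \sum_i z i = - 7) (z2 : \sum_i z i ^+ 2 = 49).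

Section Shift.

Variable a : int.
Let w i := z i - a%:~R.
Let q : {poly L} := 'X^7 + \sum_(i < 7) (septic_coef t a i)%:~R *: 'X^i.

Lemma shift_rootE i :
  w i ^+ 7 + \sum_(k < 7) (septic_coef t a k)%:~R * w i ^+ k = 0.
Proof.
have := septic_shift (R := L) t a (w i); rewrite /w subrK => <-; exact: zF.
Qed.

Let szr :
  (size (\sum_(i < 7) (septic_coef t a i)%:~R *: 'X^i : {poly L})%R < 8)%N.
Proof.
rewrite ltnS; apply: (leq_trans (size_sum _ _ _)); apply/bigmax_leqP => i _.
by rewrite (leq_trans (size_scale_leq _ _)) // size_polyXn.
Qed.

Lemma shift_prod : q = \prod_i ('X - (w i)%:P).
Proof.
have szq : size q = 8 by rewrite size_polyDl ?size_polyXn.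
have lq : lead_coef q = 1 by rewrite lead_coefDl ?size_polyXn // lead_coefXn.
have szw : size (enum 'Z_7) = 7 by rewrite -cardE card_ord.
rewrite [LHS](@all_roots_prod_XsubC _ _ [seq w i | i <- enum 'Z_7]).
- by rewrite lq scale1r big_map big_enum.
- by rewrite size_map szw szq.
- apply/allP => _ /mapP [i _ ->]; rewrite /root hornerD hornerXn horner_sum.
  rewrite -[X in _ == X](shift_rootE i); apply/eqP; congr (_ + _).
  by apply: eq_bigr => k _; rewrite hornerZ hornerXn.
rewrite uniq_rootsE map_inj_uniq ?enum_uniq // => i j.
by move/addIr/zinj.
Qed.

Lemma shift_coef k : (k < 7)%N -> q`_k = (septic_coef t a k)%:~R.
Proof.
move=> k7; rewrite coefD coefXn ltn_eqF // add0r coef_sum.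
rewrite (bigD1 (Ordinal k7)) //= coefZ coefXn eqxx mulr1 big1 ?addr0 // => i ik.
rewrite coefZ coefXn (_ : (k == i) = false) ?mulr0 //.
by apply: contraNF ik => /eqP ki; apply/eqP/val_inj.
Qed.

Lemma shift_power_sum k : (k < 7)%N ->
  \sum_i w i ^+ k = (power_sum7 (septic_coef t a) k)%:~R.
Proof.
move=> k7; rewrite (newton7 (card_ord 7) shift_prod k7).
apply: (power_sum7_morph (f := intr)) => // i /andP [_ i7].
exact: shift_coef.
Qed.

End Shift.

Lemma septic_integer i : ring_of_integers E (z i).
Proof.
split=> //; have := shift_rootE 0 i; rewrite subr0 => H.
(* With [j = 0] the polygon argument is the integrality of a root of a monic integer polynomial. *)
have H' : z i ^+ 7 + \sum_(k < 7)
    (7%:Z ^+ ((0 * (7 - k) + 5) %/ 6) * septic_coef t 0 k)%:~R * z i ^+ k = 0.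
  by rewrite -[RHS]H; congr (_ + _); apply: eq_bigr => k _; rewrite mul1r.
have := newton_polygon_integral (isT : (0 < 7)%N) H' 1.
by rewrite expr1 mul0n div0n expr0 divr1.
Qed.

Variable P : L -> Prop.
Hypothesis Pprime : is_prime_ideal E P.
Hypothesis inert : forall g x, g \in 'Gal(E / K)%g -> ring_of_integers E x ->
  P (g x - x).

Lemma inertia_not7 : P 7 -> False.
Proof.
move=> P7; have [a [d [j [k [n [cE k7 pE n7]]]]]] := septic_at7 t49.
pose w i := z i - a%:~R; pose h := ((j * k) %/ 6)%N.
pose b i := w i ^+ k / 7%:R ^+ h.
have bgal i : exists2 g, g \in 'Gal(E / K)%g & b i = g (b 0).
  have [g Gg zg] := zgal i; exists g => //.
  rewrite /b /w fmorph_div !rmorphXn rmorphB rmorph_int rmorph_nat /=.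
  by rewrite -zg.
have Ob i : ring_of_integers E (b i).
  split.
    rewrite rpred_div ?rpredX ?rpred_nat ?rpred1 // rpredB //.
    by rewrite -mulrzl rpredM ?rpredMz ?rpred1.
  apply: (@newton_polygon_integral L (w i) 7 j d) => //.
  rewrite -[RHS](shift_rootE a i); congr (_ + _); apply: eq_bigr => l _.
  by rewrite cE.
have sumb : \sum_i b i = n%:~R.
  rewrite /b -big_distrl /= shift_power_sum // pE rmorphM rmorphXn /=.
  rewrite -[(7%:Z)%:~R]/(7%:R : L) mulrAC divff ?mul1r //.
  by rewrite expf_neq0 // -(rmorph_nat (in_alg L)) fmorph_eq0.
have Pn : P n%:~R.
  have -> : n%:~R = \sum_i (b i - b 0) + 7 * b 0 :> L.
    by rewrite -sumb sumrB sumr_const card_ord mulr_natl subrK.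
  apply: (prime_idealD Pprime); last exact: (prime_idealMr Pprime).
  apply: (prime_ideal_sum Pprime) => i _; have [g Gg ->] := bgal i.
  exact: inert.
apply: (prime_ideal1 Pprime).
have [x [y xy]] := Bezoutz 7 n.
have {}xy : x * 7 + y * n = 1.
  rewrite xy; apply/eqP; change (coprimez 7 n).
  by rewrite coprimezE /= prime_coprime.
have -> : 1 = x%:~R * 7 + y%:~R * n%:~R :> L.
  by rewrite -[7]/(7%:Z%:~R) -!rmorphM -rmorphD /= xy.
by apply: (prime_idealD Pprime); apply: (prime_idealMl Pprime) => //;
  apply: integer_int.
Qed.

Lemma inertia_false : False.
Proof.
have Oz := septic_integer.
have Pz i : P (z 0 - z i).
  have [g Gg ->] := zgal i; rewrite -opprB; apply: (prime_idealN Pprime).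
  exact: inert.
have nP7 : ~ P 7 by move/inertia_not7.
have Oz1 : ring_of_integers E (z 0 + 1).
  by apply: integerD => //; apply: integer1.
have sum7 (x : L) : \sum_(i : 'Z_7) x = 7 * x.
  by rewrite sumr_const card_ord mulr_natl.
have P1 : P (z 0 + 1).
  have : P (7 * (z 0 + 1)).
    have -> : 7 * (z 0 + 1) = \sum_i (z 0 - z i).
      by rewrite sumrB z1 sum7; ring.
    by apply: (prime_ideal_sum Pprime).
  by case/(prime_ideal_or Pprime (integer_nat E 7) Oz1).
have P6 : P 6.
  have : P (7 * 6).
    have -> : 7 * 6 = \sum_i (z 0 - z i) ^+ 2 - 7 * (z 0 + 1) * (z 0 + 1).
      under eq_bigr do rewrite sqrrB.
      rewrite big_split sumrB /= z2 sum7 sumrMnl -big_distrr /= z1.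
      ring.
    apply: (prime_idealB Pprime); last first.
      by apply: (prime_idealMl Pprime) => //; apply: integerM => //;
        apply: integer_nat.
    apply: (prime_ideal_sum Pprime) => i _; rewrite expr2.
    by apply: (prime_idealMr Pprime) => //; apply: integerB.
  by case/(prime_ideal_or Pprime (integer_nat E 7) (integer_nat E 6)).
have Ou : ring_of_integers E u.
  rewrite /u /T; apply: integerD; last exact: integer_nat.
  apply: integerB; first by apply: integerX; apply: integer_int.
  by apply: integerM; [apply: integer_nat | apply: integer_int].
have PF : P (7 * z 0 ^+ 6 + 42 * z 0 ^+ 5 - 224 * u * z 0 + 448 * u).
  have -> : 7 * z 0 ^+ 6 + 42 * z 0 ^+ 5 - 224 * u * z 0 + 448 * u =
      \prod_(i | i != 0) (z 0 - z i).
    under [RHS]eq_bigr => i _ do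
      rewrite -[z 0](subr0 (z 0)) -[z i](subr0 (z i)) -[0 : L]/(0%:~R).
    rewrite -(horner_deriv_prod (shift_prod 0)) derivD derivXn.
    rewrite !big_ord_recl big_ord0 /septic_coef !derivD !derivZ !derivXn derivC.
    rewrite !(hornerD, hornerZ, hornerMn, hornerXn, hornerX, hornerC) /bump /=
      subr0.
    rewrite /u /T; ring.
  rewrite (bigD1 1) //=; apply: (prime_idealMr Pprime) => //.
  by apply: integer_prod => i _; apply: integerB.
(* The quotient of the derivative by [z + 1]. The remainder, its value at -1, is [672 u - 35], which
   is 1 modulo 6. *)
pose r := 7 * z 0 ^+ 5 + 35 * z 0 ^+ 4 - 35 * z 0 ^+ 3 + 35 * z 0 ^+ 2
  - 35 * z 0 + 35 - 224 * u.
have Or : ring_of_integers E r.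
  by rewrite /r; repeat first [exact: Oz | exact: Ou | apply: integer_nat
    | apply: integerX | apply: integerM | apply: integerB | apply: integerD].
apply: (prime_ideal1 Pprime).
have -> : 1 = 7 * z 0 ^+ 6 + 42 * z 0 ^+ 5 - 224 * u * z 0 + 448 * u
    - r * (z 0 + 1) + (6 - 112 * u) * 6 by rewrite /r; ring.
apply: (prime_idealD Pprime); first apply: (prime_idealB Pprime) => //.
  exact: (prime_idealMl Pprime).
apply: (prime_idealMl Pprime) => //; apply: integerB; first exact: integer_nat.
by apply: integerM => //; apply: integer_nat.
Qed.

End UnramifiedFinite.

Lemma unramified_infinite_imaginary (L : fieldExtType rat) (K E : {subfield L})
    (s : L) (n : int) :
  (K <= E)%VS -> s \in K -> s ^+ 2 = n%:~R -> n < 0 -> unramified_infinite K E.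
Proof.
move=> KE Ks s2 n0 f fK; exfalso; have Es := subvP KE _ Ks.
have sE : vsval (vsproj E s) = s by apply: vsprojK.
have fs : f (vsproj E s) \is Num.real by apply: fK; rewrite sE.
have := real_exprn_even_ge0 (n := 2) fs isT.
have -> : f (vsproj E s) ^+ 2 = n%:~R.
  rewrite -rmorphXn -(rmorph_int f); congr (f _); apply/val_inj.
  have -> : val (n%:~R : subvs_of E) = n%:~R.
    exact: (rmorph_int (vsval : {rmorphism subvs_of E -> L})).
  by rewrite -s2 !expr2 /= sE.
by rewrite ler0z leNgt n0.
Qed.

Theorem theorem10 (t : int)
    (ht : (t %% 49)%Z \in [:: 0; 5; 8; 17; 20; 25])
    (hcubic : irreducible_poly (cubic t))
    (L : splittingFieldType rat) (y : L)
    (hy : root (map_poly (in_alg L) (cubic t)) y) :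
  cyclic_extension 1%AS <<1; y>>%AS /\
  (irreducible_poly (septic t) ->
   forall (s : L) (hs : s ^+ 2 = (- 7 * (t ^+ 2 - 3 * t + 9))%:~R)
     (E : {subfield L}),
     let K : {subfield L} := <<1 & [:: s; y]>>%AS in
     splittingFieldFor K (map_poly (in_alg L) (septic t)) E ->
     cyclic_extension K E /\ unramified_extension K E).
Proof.
split; first exact: (cubic_extension_cyclic hcubic hy).
move=> hseptic s hs E K splitE.
have [galKE G7 [z [zinj Ez zF zgal [z1 z2]]]] :=
  septic_galois hcubic hseptic hy hs splitE.
have prG : prime #|'Gal(E / K)%g| by rewrite G7.
have KE : (K <= E)%VS by case/and3P: galKE.
split; first by split=> //; apply: prime_cyclic.
split=> //; last first.
  apply: (unramified_infinite_imaginary KE _ hs); last by nia.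
  by apply: seqv_sub_adjoin; rewrite mem_head.
(* By the contrapositive of [ramification_index1], every element of the Galois group would then lie
   in the inertia group at [P]. *)
move=> P Pprime Pnz; apply: NNPP => ram.
apply: (inertia_false ht zinj Ez zF zgal z1 z2 Pprime) => g x Gg Ox.
by apply: NNPP => nP; apply: ram;
  apply: (ramification_index1 galKE prG Pprime Pnz Gg Ox nP).
Qed.
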